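(* Let $(X,\mathcal{F}_X)$ be a locally compact Sikorski space satisfying the following condition: for each point of $X$ there is a neighbourhood that is Sikorski diffeomorphic to a convex subset of a cartesian space. Then the Sikorski structure on $X$ is reflexive, i.e. $\Phi\Pi\mathcal{F}_X=\mathcal{F}_X$.
   Context: ''Smooth'' means $C^\infty$. A cartesian space is $\mathbb{R}^d$ for some $d\in\mathbb{N}$, with its standard smooth structure. Sikorski structures. A Sikorski structure on a set $X$ is a non-empty collection $\mathcal{F}_X$ of real-valued functions on $X$ such that, with $X$ equipped with the initial topology (the weakest topology making all functions in $\mathcal{F}_X$ continuous): (S1) if $f_1,\ldots,f_n\in\mathcal{F}_X$ and $g\in C^\infty(\mathbb{R}^n)$, then $g\circ(f_1,\ldots,f_n)\in\mathcal{F}_X$; (S2) given $f\colon X\to\mathbb{R}$, if for each point of $X$ there exist a neighbourhood $V$ and $g\in\mathcal{F}_X$ with $g|_V=f|_V$, then $f\in\mathcal{F}_X$. A Sikorski space is always equipped with its initial topology; ''locally compact'' and ''neighbourhood'' refer to this topology. A map between Sikorski spaces $(X,\mathcal{F}_X)\to(Y,\mathcal{F}_Y)$ is Sikorski smooth if its composition with every function in $\mathcal{F}_Y$ is in $\mathcal{F}_X$; a Sikorski diffeomorphism is a bijection that is Sikorski smooth with Sikorski smooth inverse. A manifold (in particular an open subset of a cartesian space) carries the Sikorski structure of all $C^\infty$ real-valued functions. For a subset $V$ of a Sikorski space $(X,\mathcal{F}_X)$, the subspace Sikorski structure is the set of functions $f\colon V\to\mathbb{R}$ such that each point of $V$ has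 a neighbourhood $W$ in $X$ and a function $g\in\mathcal{F}_X$ with $g|_{V\cap W}=f|_{V\cap W}$. Subsets of $X$ and (convex) subsets of cartesian spaces are equipped with their subspace Sikorski structures. Diffeologies. A diffeology on a set $X$ is a collection $\mathcal{D}_X$ of maps (plots) from open subsets of cartesian spaces to $X$ such that: (D1) constant maps are plots; (D2) precompositions of plots with $C^\infty$ maps between open subsets of cartesian spaces are plots; (D3) $p\colon U\to X$ is a plot if each point of $U$ has a neighbourhood $V$ with $p|_V$ a plot. A map between diffeological spaces is diffeologically smooth if its precomposition with every plot of the source is a plot of the target; a manifold carries the diffeology of all $C^\infty$ maps from open subsets of cartesian spaces. For a Sikorski structure $\mathcal{F}_X$, $\Pi\mathcal{F}_X$ denotes the diffeology of all Sikorski smooth maps from open subsets of cartesian spaces to $X$. For a diffeology $\mathcal{D}_X$, $\Phi\mathcal{D}_X$ denotes the Sikorski structure of all diffeologically smooth real-valued functions on $X$. A Sikorski structure $\mathcal{F}_X$ is reflexive if $\Phi\Pi\mathcal{F}_X=\mathcal{F}_X$. *)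

(* Defs.v *)
From HB Require Import structures.
From mathcomp Require Import all_boot all_order all_algebra finmap.
From mathcomp Require Import all_classical all_reals all_analysis.

Set Implicit Arguments.
Unset Strict Implicit.
Unset Printing Implicit Defensive.

Import Order.TTheory GRing.Theory Num.Theory.
Import numFieldNormedType.Exports.

Local Open Scope classical_set_scope.
Local Open Scope ring_scope.

Section Smooth.
Context {R : realType}.

(* For s = [:: i1; ...; ik], the function d/dx_i1 (... (d/dx_ik f)). *)
Definition iter_partial n (f : 'rV[R]_n -> R) (s : seq 'I_n) : 'rV[R]_n -> R :=
  foldr (fun i g => 'D_(delta_mx 0 i) g) f s.

(* Meant for U open: f is C^oo on U when all its iterated partial derivatives
   exist and are continuous at the points of U. Only the germs of f at the
   points of U matter, so the values of f outside U are irrelevant. *)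
Definition smooth_on n (U : set 'rV[R]_n) (f : 'rV[R]_n -> R) : Prop :=
  forall (s : seq 'I_n) (x : 'rV[R]_n), U x ->
    {for x, continuous (iter_partial f s)} /\
    forall i : 'I_n, derivable (iter_partial f s) x (delta_mx 0 i).

Definition cartesian_smooth n : set ('rV[R]_n -> R) :=
  [set f | smooth_on setT f].

(* C^oo(U) for U open, as functions defined on U only; the extension g is
   arbitrary (not even continuous) outside U. *)
Definition open_smooth n (U : set 'rV[R]_n) : set (U -> R) :=
  [set f | exists2 g : 'rV[R]_n -> R,
     smooth_on U g & forall u : U, g (\val u) = f u].

End Smooth.
Arguments cartesian_smooth : clear implicits.
Arguments open_smooth {R n} U.

Section Sikorski.
Context {R : realType}.

Definition sikorski_space (X : Type) (F : set (X -> R)) : Type := {classic X}.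

Definition initial_subbase (X : Type) (F : set (X -> R)) : set (set X) :=
  [set f @^-1` A | f in F & A in open].

HB.instance Definition _ (X : Type) (F : set (X -> R)) :=
  Choice.on (sikorski_space F).
HB.instance Definition _ (X : Type) (F : set (X -> R)) :=
  isSubBaseTopological.Build (sikorski_space F) (initial_subbase F) id.

Lemma sikorski_cvgP (X : Type) (F : set (X -> R))
    (G : set_system (sikorski_space F)) (x : sikorski_space F) :
  Filter G ->
  G --> x <-> forall f : sikorski_space F -> R, F f -> f @ G --> f x.
Proof.
move=> FG; split=> [Gx f Ff A|GF A].
  rewrite nbhsE => -[B [oB Bfx] BA]; apply: filterS BA _.
  apply: Gx; exists (f @^-1` B); split=> //.
  exists [set f @^-1` B]; last first.
    by rewrite predeqE => y; split=> [[_ ->]|] //; exists (f @^-1` B).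
  move=> _ ->; exists [fset (f @^-1` B)]%fset.
    by move=> C; rewrite inE inE => /eqP->; exists f => //; exists B.
  rewrite predeqE => y; split=> [/(_ (f @^-1` B))|Bfy C].
    by apply; rewrite /= inE.
  by rewrite /= inE => /eqP ->.
rewrite nbhsE => -[_ [[B sB <-] [C BC Cx]] BA].
apply: filterS BA _; apply: (@filterS _ _ _ C) => [y Cy|]; first by exists C.
have [D sD CE] := sB _ BC; rewrite -CE; apply: filter_bigI => E DE.
have := sD _ DE; rewrite inE => -[f Ff [U oU UE]].
rewrite /= -UE; apply: (GF f Ff); apply: open_nbhs_nbhs; split=> //.
by move: Cx; rewrite -CE => /(_ _ DE); rewrite -UE.
Qed.

Lemma sikorski_continuous (X : Type) (F : set (X -> R)) (f : X -> R) :
  F f -> continuous (f : sikorski_space F -> R).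
Proof.
move=> Ff x.
by apply: ((@sikorski_cvgP X F (nbhs x) x _).1 _ f Ff); exact: cvg_id.
Qed.

Lemma sikorski_regular (X : Type) (F : set (X -> R)) :
  @regular_space (sikorski_space F).
Proof.
move=> x; apply/sikorski_cvgP => [|f Ff A fxA].
  apply: filter_from_filter; first by exists setT; exact: filterT.
  move=> A B xA xB; exists (A `&` B); first exact: filterI.
  exact: closureI.
have [B fxB BA] := @uniform_regular R (f x) A fxA.
have cf := @sikorski_continuous X F f Ff.
exists (f @^-1` B); first exact: cf.
move=> y yB; apply: BA => C /cf fyC.
by have [z [? ?]] := yB _ fyC; exists (f z).
Qed.

Record is_sikorski (X : Type) (F : set (X -> R)) : Prop := IsSikorski {
  sikorski_nonempty : F !=set0 ;
  sikorski_comp : forall n (f : 'I_n -> X -> R) (g : 'rV[R]_n -> R),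
    (forall i, F (f i)) -> cartesian_smooth R n g ->
    F (fun x => g (\row_i f i x)) ;
  sikorski_local : forall f : X -> R,
    (forall x : sikorski_space F, exists (V : set X) (g : X -> R),
      [/\ nbhs x V, F g & forall y, V y -> g y = f y]) ->
    F f
}.

Definition sikorski_smooth (X Y : Type) (FX : set (X -> R)) (FY : set (Y -> R))
    (phi : X -> Y) : Prop :=
  forall g, FY g -> FX (g \o phi).

Definition sikorski_diffeomorphic (X Y : Type)
    (FX : set (X -> R)) (FY : set (Y -> R)) : Prop :=
  exists (phi : X -> Y) (psi : Y -> X),
    [/\ cancel phi psi, cancel psi phi,
        sikorski_smooth FX FY phi & sikorski_smooth FY FX psi].

Definition subspace_sikorski (X : Type) (F : set (X -> R)) (V : set X) :
    set (V -> R) :=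
  [set f | forall v : V, exists (W : set X) (g : X -> R),
     [/\ nbhs (\val v : sikorski_space F) W, F g &
         forall w : V, W (\val w) -> g (\val w) = f w]].

(* The library's locally_compact asks for compact neighbourhoods that are also
   closed; initial topologies need not be Hausdorff but they are regular, so
   this agrees with asking for compact neighbourhoods only. *)
Lemma sikorski_locally_compactP (X : Type) (F : set (X -> R)) :
  locally_compact [set: sikorski_space F] <->
  forall x : sikorski_space F,
    exists2 K : set (sikorski_space F), nbhs x K & compact K.
Proof.
split=> [lc x|lc x _].
  have [K xK [cK _]] := lc x I.
  exists K => //; move: xK; rewrite /within /=.
  by apply: filterS => y; exact.
have [K xK cK] := lc x.
have [V xV VK] := @sikorski_regular X F x K xK.
exists (closure V).
  by apply: filterS xV => y Vy _; exact: subset_closure.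
split; last exact: closed_closure.
exact: subclosed_compact (@closed_closure _ V) cK VK.
Qed.

End Sikorski.
Arguments subspace_sikorski {R X} F V.

Section Diffeology.
Context {R : realType}.

Definition plot_collection (X : Type) : Type :=
  forall d (U : set 'rV[R]_d), set (U -> X).

Definition diffeologically_smooth (X Y : Type)
    (DX : plot_collection X) (DY : plot_collection Y) (h : X -> Y) : Prop :=
  forall d (U : set 'rV[R]_d) (p : U -> X), DX d U p -> DY d U (h \o p).

Definition real_diffeology : plot_collection R :=
  fun d U => [set p | open U /\ open_smooth U p].

Definition Pi_diffeology (X : Type) (F : set (X -> R)) : plot_collection X :=
  fun d U => [set p | open U /\ sikorski_smooth (open_smooth U) F p].

Definition Phi_sikorski (X : Type) (D : plot_collection X) : set (X -> R) :=
  [set f | diffeologically_smooth D real_diffeology f].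

Definition reflexive_sikorski (X : Type) (F : set (X -> R)) : Prop :=
  Phi_sikorski (Pi_diffeology F) = F.

End Diffeology.

(* Main.v *)
From HB Require Import structures.
Require Import Defs.
From mathcomp Require Import all_boot all_order all_algebra.
From mathcomp Require Import all_classical all_reals all_analysis.
From mathcomp Require Import zify ring lra.
Set Implicit Arguments.
Unset Strict Implicit.
Unset Printing Implicit Defensive.
Import Order.TTheory GRing.Theory Num.Theory.
Import numFieldNormedType.Exports.
Local Open Scope classical_set_scope.
Local Open Scope ring_scope.

(** A function of F is diffeologically smooth by definition; the content is the
    converse, which is a local statement.  In a chart it reads as follows: a
    function h on a convex set C of R^n whose composite with every smooth map
    from an open set into C is smooth ([plot_smooth]) coincides, near each point
    of C, with a smooth function on R^n ([plot_smooth_extension]).  Local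
    compactness of the space makes C locally closed ([chart_compact],
    [chart_inverse_continuous]), without which this fails.

    One may assume that C has interior points: otherwise h is pulled back along
    a linear projection onto the affine hull of C.

    _Derivatives at the boundary._  If v points strictly inwards, x + t^2 v stays
    in C for t small, and half the second derivative of h (x + t^2 v) at t = 0 is
    the one-sided derivative of h at x along v.  When x runs along a plot, so does
    (x, t), hence this derivative is again smooth along plots
    ([plot_smooth_square_derive]).  Inward directions form an open cone and so
    span R^n: every iterated partial derivative of h extends from the interior to
    a function on C that is smooth along plots ([plot_smooth_iter_partial]).  Such
    functions are continuous, because every fast convergent sequence of C lies on
    a smooth curve in C ([plot_smooth_continuous]).  As C is locally closed, all
    the derivatives of h are bounded near a given point of C.

    _Extension across the boundary_ ([smooth_extension]).  Let e point inwards and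
    let tau be the translation by eps e.  The operator 1 - (1 - tau)^(N+1) involves
    positive powers of tau only; applied to h it yields a function T that is smooth
    in a neighbourhood of C of width comparable to eps, and h - T is a finite
    difference of order N + 1, of size eps^(N+1).  Take eps_i = c / 2^i and
    orders N_i that tend to infinity so slowly that the bounds on the derivatives
    of h involved grow at most like 2^i ([slow_sequence]).  Let chi_i be equal to 1
    on C near the given point and vanish farther than r eps_i from there, with derivatives bounded
    by powers of 1 / eps_i ([cutoff_exists]).  Since N_i exceeds any given power,
    the series chi_0 T_0 + sum_i chi_(i+1) (T_(i+1) - T_i) converges with all its
    derivatives ([smooth_series]); on C it telescopes to the limit of T_i, that
    is to h. *)

(** * Differential calculus of class C^k *)

Section Calculus.
Context {R : realType}.

Lemma mvt_bound (g dg : R -> R) (a b K : R) :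
  (forall t, Num.min a b <= t <= Num.max a b -> is_derive t 1 g (dg t)) ->
  (forall t, Num.min a b <= t <= Num.max a b -> `|dg t| <= K) ->
  `|g b - g a| <= K * `|b - a|.
Proof.
wlog ab : a b / a <= b => [wl|] dgP dgK.
  case: (leP a b) => [ab|/ltW ba]; first exact: wl.
  rewrite distrC [`|b - a|]distrC; apply: wl => // t; rewrite minC maxC.
    exact: dgP.
  exact: dgK.
move: dgP dgK; rewrite (min_idPl ab) (max_idPr ab) => dgP dgK.
have [c cab ->] : exists2 c, c \in `[a, b]%R & g b - g a = dg c * (b - a).
  apply: MVT_segment => //.
    by move=> t; rewrite in_itv/= => /andP[at_ tb]; apply: dgP; rewrite !ltW.
  apply: derivable_within_continuous => t; rewrite in_itv/= => tab.
  by have [] := dgP _ tab.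
by rewrite normrM ler_wpM2r// dgK//; move: cab; rewrite in_itv.
Qed.

Lemma rV_norm_le n (x : 'rV[R]_n) c :
  0 <= c -> (`|x| <= c) <-> (forall j, `|x 0 j| <= c).
Proof.
move=> c0; rewrite [`|x|]/Num.Def.normr/= mx_normrE; split.
  move=> xc j; apply: le_trans xc.
  exact: (@le_bigmax _ _ _ _ (fun ij : 'I_1 * 'I_n => `|x ij.1 ij.2|) (0, j)).
by move=> xc; rewrite bigmax_le// => -[i j] _ /=; rewrite ord1.
Qed.

Lemma rV_norm_lt n (x : 'rV[R]_n) c :
  0 < c -> (`|x| < c) <-> (forall j, `|x 0 j| < c).
Proof.
move=> c0; rewrite [`|x|]/Num.Def.normr/= mx_normrE; split.
  move=> xc j; apply: le_lt_trans xc.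
  exact: (@le_bigmax _ _ _ _ (fun ij : 'I_1 * 'I_n => `|x ij.1 ij.2|) (0, j)).
by move=> xc; rewrite bigmax_lt// => -[i j] _ /=; rewrite ord1.
Qed.

Lemma coord_norm_le n (x : 'rV[R]_n) j : `|x 0 j| <= `|x|.
Proof. exact: (rV_norm_le x (normr_ge0 x)).1. Qed.

Lemma continuous_coords (T : topologicalType) n (p : T -> 'rV[R]_n) (x : T) :
  (forall j, {for x, continuous (fun u => p u 0 j)}) -> {for x, continuous p}.
Proof.
move=> pc; apply/cvgrPdist_lt => e e0.
have : \forall u \near x, forall j, `|p x 0 j - p u 0 j| < e.
  by apply: filter_forall => j; have /cvgrPdist_lt := pc j; exact.
by apply: filterS => u pu; apply/rV_norm_lt => // j; rewrite !mxE.
Qed.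

Section Ck.
Variables (n : nat).
Implicit Types (U : set 'rV[R]_n) (f g : 'rV[R]_n -> R).

Local Notation e i := (delta_mx 0 i : 'rV[R]_n).

(** Induction on the order is what makes products, inverses and compositions
    tractable: their partial derivatives are again sums of products of functions of
    one order less. *)
Fixpoint Ck U (k : nat) f : Prop :=
  (forall x, U x -> {for x, continuous f}) /\
  (if k is k'.+1 then
    forall i, (forall x, U x -> derivable f x (e i)) /\ Ck U k' ('D_(e i) f)
   else True).

Lemma Ck_continuous U k f x : Ck U k f -> U x -> {for x, continuous f}.
Proof. by case: k => [|k] [fc _]; exact: fc. Qed.

Lemma CkW U k f : Ck U k.+1 f -> Ck U k f.
Proof.
elim: k f => [|k IH] f; first by case.
move=> [fc fd]; split => // i; have [? ?] := fd i; split => //.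
exact: IH.
Qed.

Lemma smooth_on_partial U f i : smooth_on U f -> smooth_on U ('D_(e i) f).
Proof.
by move=> fs s x Ux; have := fs (rcons s i) x Ux; rewrite /iter_partial foldr_rcons.
Qed.

Lemma smooth_onP U f : smooth_on U f <-> forall k, Ck U k f.
Proof.
split=> [fs k|fC s].
  elim: k f fs => [|k IH] f fs; split=> //.
  - by move=> x Ux; have [] := fs [::] x Ux.
  - by move=> x Ux; have [] := fs [::] x Ux.
  - move=> i; split; first by move=> x Ux; have [_] := fs [::] x Ux; apply.
    exact/IH/smooth_on_partial.
suff : Ck U 1 (iter_partial f s).
  by move=> [c d] x Ux; split=> [|i]; [exact: c|have [+ _] := d i; apply].
move: {fC} (fC (size s).+1).
elim/last_ind: s f => [//|s i IH] f.
rewrite size_rcons /iter_partial foldr_rcons => -[_ fd].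
by apply: IH; have [] := fd i.
Qed.

Lemma near_open_eq U f g : open U -> {in U, f =1 g} ->
  forall x, U x -> {near x, f =1 g}.
Proof.
move=> oU fg x Ux; apply: filterS (open_nbhs_nbhs (conj oU Ux)) => y Uy.
by apply: fg; rewrite inE.
Qed.

Lemma Ck_ext U k f g : open U -> {in U, f =1 g} -> Ck U k f -> Ck U k g.
Proof.
move=> oU; elim: k f g => [|k IH] f g fg [fc fd];
  have fgx := near_open_eq oU fg.
  split=> // x Ux; rewrite /prop_for /continuous_at.
  rewrite -(fg x (mem_set Ux)); apply: cvg_trans (fc x Ux).
  exact: (near_eq_cvg (fgx x Ux)).
split=> [x Ux|i].
  rewrite /prop_for /continuous_at -(fg x (mem_set Ux)).
  exact: cvg_trans (near_eq_cvg (fgx x Ux)) (fc x Ux).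
have [fdi fCi] := fd i; split=> [x Ux|].
  exact: near_eq_derivable (fgx x Ux) (fdi x Ux).
apply: IH fCi => x /set_mem Ux; exact: near_eq_derive (fgx x Ux).
Qed.

Lemma smooth_on_ext U f g : open U -> {in U, f =1 g} ->
  smooth_on U f -> smooth_on U g.
Proof. by move=> oU fg /smooth_onP fC; apply/smooth_onP => k; exact: Ck_ext fg _. Qed.

Lemma iter_partial_ext U f g s : open U -> {in U, f =1 g} ->
  {in U, iter_partial f s =1 iter_partial g s}.
Proof.
move=> oU fg; elim: s => [//|i s IH] x /set_mem Ux.
exact: near_eq_derive (near_open_eq oU IH Ux).
Qed.

Lemma Ck_deriv U k f (df : 'I_n -> 'rV[R]_n -> R) : open U ->
  (forall x, U x -> {for x, continuous f}) ->
  (forall i x, U x -> is_derive x (e i) f (df i x)) ->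
  (forall i, Ck U k (df i)) -> Ck U k.+1 f.
Proof.
move=> oU fc fd dfC; split=> // i; split=> [x Ux|]; first by have [] := fd i x Ux.
apply: Ck_ext (dfC i) => // x /set_mem Ux; by rewrite (@derive_val _ _ _ _ _ _ _ (fd i x Ux)).
Qed.

Lemma Ck_is_derive U k f i x : Ck U k.+1 f -> U x ->
  is_derive x (e i) f ('D_(e i) f x).
Proof. by move=> [_ fd] Ux; apply: derivableP; have [+ _] := fd i; apply. Qed.

Lemma Ck_partial U k f i : Ck U k.+1 f -> Ck U k ('D_(e i) f).
Proof. by move=> [_ fd]; have [] := fd i. Qed.

Lemma Ck_cst U k c : Ck U k (cst c).
Proof.
have cc c' x : {for x, continuous (cst c' : 'rV[R]_n -> R)} by apply: cst_continuous.
elim: k c => [|k IH] c; split=> // i; split=> [x _|]; first exact: derivable_cst.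
rewrite (_ : 'D_(e i) _ = cst 0); first exact: IH.
by apply/funext => x; rewrite derive_cst.
Qed.

Lemma Ck_add U k f g : open U -> Ck U k f -> Ck U k g -> Ck U k (fun x => f x + g x).
Proof.
move=> oU; elim: k f g => [|k IH] f g fC gC.
  by split=> // x Ux; apply: continuousD; [exact: (Ck_continuous fC Ux)|exact: (Ck_continuous gC Ux)].
apply: (@Ck_deriv _ _ _ (fun i x => 'D_(e i) f x + 'D_(e i) g x)) => //.
- by move=> x Ux; apply: continuousD; [exact: (Ck_continuous fC Ux)|exact: (Ck_continuous gC Ux)].
- by move=> i x Ux; apply: is_deriveD; [exact: (Ck_is_derive i fC Ux)|exact: (Ck_is_derive i gC Ux)].
- by move=> i; apply: IH; exact: Ck_partial.
Qed.

Lemma Ck_mul U k f g : open U -> Ck U k f -> Ck U k g -> Ck U k (fun x => f x * g x).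
Proof.
move=> oU; elim: k f g => [|k IH] f g fC gC.
  by split=> // x Ux; apply: continuousM; [exact: (Ck_continuous fC Ux)|exact: (Ck_continuous gC Ux)].
apply: (@Ck_deriv _ _ _ (fun i x => f x * 'D_(e i) g x + g x * 'D_(e i) f x)) => //.
- by move=> x Ux; apply: continuousM; [exact: (Ck_continuous fC Ux)|exact: (Ck_continuous gC Ux)].
- by move=> i x Ux; apply: is_deriveM; [exact: (Ck_is_derive i fC Ux)|exact: (Ck_is_derive i gC Ux)].
- by move=> i; apply: Ck_add => //; apply: IH; do ?[exact: Ck_partial|exact: CkW].
Qed.

Lemma Ck_inv U k f : open U -> (forall x, U x -> f x != 0) ->
  Ck U k f -> Ck U k (fun x => (f x)^-1).
Proof.
move=> oU f0; elim: k => [|k IH] fC.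
  by split=> // x Ux; apply: continuousV; [exact: f0|exact: (Ck_continuous fC Ux)].
have fvC := IH (CkW fC).
apply: (@Ck_deriv _ _ _ (fun i x => -1 * ((f x)^-1 * (f x)^-1) * 'D_(e i) f x)) => //.
- by move=> x Ux; apply: continuousV; [exact: f0|exact: (Ck_continuous fC Ux)].
- move=> i x Ux; have [fd _] := Ck_is_derive i fC Ux.
  split; first exact: derivableV (f0 x Ux) fd.
  rewrite deriveV//; last exact: f0.
  by rewrite -[_ *: _]/(_ * _) mulN1r -invfM -expr2.
- move=> i; do ![apply: Ck_mul => //]; [exact: Ck_cst| exact: Ck_partial].
Qed.

Lemma Ck_sum U k (I : Type) (r : seq I) (F : I -> 'rV[R]_n -> R) : open U ->
  (forall i, Ck U k (F i)) -> Ck U k (fun x => \sum_(i <- r) F i x).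
Proof.
move=> oU FC; elim: r => [|a r IH].
  rewrite (_ : (fun _ => _) = cst 0); first exact: Ck_cst.
  by apply/funext => x; rewrite big_nil.
under eq_fun do rewrite big_cons.
exact: Ck_add.
Qed.

Lemma Ck_prod U k (I : Type) (r : seq I) (F : I -> 'rV[R]_n -> R) : open U ->
  (forall i, Ck U k (F i)) -> Ck U k (fun x => \prod_(i <- r) F i x).
Proof.
move=> oU FC; elim: r => [|a r IH].
  rewrite (_ : (fun _ => _) = cst 1); first exact: Ck_cst.
  by apply/funext => x; rewrite big_nil.
under eq_fun do rewrite big_cons.
exact: Ck_mul.
Qed.

Lemma is_derive_coord (x v : 'rV[R]_n) j : is_derive x v (fun u : 'rV[R]_n => u 0 j) (v 0 j).
Proof.
have /derivable_mxP/(_ 0 j) d := @derivable_id R _ x v.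
split; first exact: d.
have := derive_mx (@derivable_id R _ x v); rewrite derive_id.
by move=> /matrixP/(_ 0 j); rewrite mxE => ->.
Qed.

Lemma Ck_coord U k j : open U -> Ck U k (fun x => x 0 j).
Proof.
move=> oU; have cc x : {for x, continuous (fun u : 'rV[R]_n => u 0 j)}.
  exact: coord_continuous.
case: k => [|k]; first by split.
apply: (@Ck_deriv _ _ _ (fun i => cst (e i 0 j))) => //.
  by move=> i x _; exact: is_derive_coord.
by move=> i; exact: Ck_cst.
Qed.

End Ck.
End Calculus.

Section Chain.
Context {R : realType}.
Local Notation e i := (delta_mx 0 i : 'rV[R]_ _).

Lemma line_growth_rate (V : normedModType R) (f : V -> R) (a v : V) (t : R) :
  (fun h : R => h^-1 *: (((fun s => f (a + s *: v)) \o shift t) (h *: 1) - f (a + t *: v)))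
  = (fun h => h^-1 *: ((f \o shift (a + t *: v)) (h *: v) - f (a + t *: v))).
Proof.
apply/funext => h /=; congr (_ *: (f _ - _)).
by rewrite addrCA -scalerDl -[h *: 1]/(h * 1) mulr1.
Qed.

Lemma is_derive_line (V : normedModType R) (f : V -> R) (a v : V) (t d : R) :
  is_derive (a + t *: v) v f d -> is_derive t 1 (fun s => f (a + s *: v)) d.
Proof.
by move=> [fd fv]; split; rewrite /derivable /derive line_growth_rate.
Qed.

Lemma is_derive_mulr (c t : R) : is_derive t 1 (fun s : R => s * c) c.
Proof.
apply: (@is_derive_eq _ _ _ _ _ _ _ _ (is_deriveM (is_derive_id t 1) (is_derive_cst c t 1))).
by rewrite scaler0 add0r -[_ *: _]/(_ * _) mulr1.
Qed.

Lemma line_is_derive (V : normedModType R) (f : V -> R) (a v : V) (t d : R) :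
  is_derive t 1 (fun s => f (a + s *: v)) d -> is_derive (a + t *: v) v f d.
Proof.
by move=> [fd fv]; split; [rewrite /derivable -line_growth_rate|rewrite -fv /derive line_growth_rate].
Qed.

Lemma diff_increment (V W : normedModType R) (f : V -> W) (df : {linear V -> W}) (x : V) :
  continuous df ->
  (forall eps, 0 < eps -> \forall h \near (0 : V),
     `|f (h + x) - f x - df h| <= eps * `|h|) ->
  differentiable f x /\ 'd f x = df :> (V -> W).
Proof.
move=> dfc fE.
have fx : f \o shift x = cst (f x) + df +o_ 0 id.
  apply/eqaddoP => eps eps0; apply: filterS (fE eps eps0) => h /=.
  by rewrite opprD addrA.
have dE := diff_unique dfc fx.
by split => //; apply/diff_locallyP; rewrite dE.
Qed.

Section C1.
Variables (n : nat) (f : 'rV[R]_n -> R) (x : 'rV[R]_n).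

Definition grad_dot (h : 'rV[R]_n) : R := \sum_(j < n) h 0 j * 'D_(e j) f x.

Fact grad_dot_linear : linear (grad_dot : 'rV[R]_n -> R).
Proof.
move=> a u v; rewrite /grad_dot scaler_sumr -big_split/=; apply: eq_bigr => j _.
by rewrite !mxE mulrDl -[_ *: _]/(_ * _) mulrA.
Qed.
HB.instance Definition _ :=
  GRing.isLinear.Build R 'rV[R]_n R _ grad_dot grad_dot_linear.

(** Go from x to x + h one coordinate at a time and apply the mean value
    inequality to each step: all the intermediate points stay in the box of radius
    |h| around x, where the partial derivatives are close to those at x. *)
Lemma C1_increment (U : set 'rV[R]_n) : open U -> Ck U 1 f -> U x ->
  forall eps, 0 < eps -> \forall h \near (0 : 'rV[R]_n),
    `|f (h + x) - f x - grad_dot h| <= eps * `|h|.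
Proof.
move=> oU fC Ux eps eps0.
have n0 : 0 < n.+1%:R :> R by rewrite ltr0n.
have nU : \forall y \near x, U y by exact: open_nbhs_nbhs.
have nD : \forall y \near x, forall j : 'I_n, `|'D_(e j) f y - 'D_(e j) f x| <= eps / n.+1%:R.
  apply: (@filter_forall _ _ _ (nbhs x) _) => j.
  have /cvgrPdist_le := Ck_continuous (Ck_partial j fC) Ux.
  move=> /(_ _ (divr_gt0 eps0 n0)).
  by apply: filterS => y; rewrite distrC.
have [d /= d0 dU] := (nbhs_normP _ _).1 (filterI nU nD).
apply/nbhs_normP; exists d => //= h.
rewrite /ball_/= sub0r normrN => hd.
(* [p k] is x with its first k coordinates increased by those of h *)
pose p k : 'rV[R]_n := x + \row_j (if (j < k)%N then h 0 j else 0).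
have pbox (j : 'I_n) t : `|t| <= `|h 0 j| -> `|x - (p j + t *: e j)| < d.
  move=> th; rewrite opprD addrA opprD addrA subrr sub0r.
  apply/rV_norm_lt => // i; rewrite !mxE -opprD normrN /=.
  have hi := le_lt_trans (coord_norm_le h i) hd.
  have hj := le_lt_trans (coord_norm_le h j) hd.
  have [->|nij] := eqVneq i j.
    by rewrite ltnn add0r mulr1; exact: le_lt_trans th _.
  by rewrite mulr0 addr0; case: ifP => // _; rewrite normr0.
have pS (j : 'I_n) : p j.+1 = p j + h 0 j *: e j.
  rewrite /p -addrA; congr (_ + _); apply/rowP => i; rewrite !mxE /=.
  rewrite ltnS leq_eqVlt -val_eqE /=; case: eqP => [/val_inj->|_] /=.
    by rewrite ltnn add0r mulr1.
  by rewrite mulr0 addr0.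
have step (j : 'I_n) : `|f (p j.+1) - f (p j) - h 0 j * 'D_(e j) f x| <= eps / n.+1%:R * `|h|.
  pose g t := f (p j + t *: e j) - t * 'D_(e j) f x.
  have -> : f (p j.+1) - f (p j) - h 0 j * 'D_(e j) f x = g (h 0 j) - g 0.
    by rewrite /g scale0r addr0 mul0r subr0 pS addrAC.
  apply: (@le_trans _ _ (eps / n.+1%:R * `|h 0 j - 0|)); last first.
    by rewrite subr0 ler_wpM2l ?coord_norm_le// divr_ge0// ltW.
  have tb t : Num.min 0 (h 0 j) <= t <= Num.max 0 (h 0 j) -> `|t| <= `|h 0 j|.
    rewrite minEle maxEle; case: (leP 0 (h 0 j)) => [h0|/ltW h0] /andP[t1 t2].
      by rewrite (ger0_norm t1) (ger0_norm h0).
    by rewrite (ler0_norm t2) (ler0_norm h0) lerN2.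
  apply: (@mvt_bound _ g (fun t => 'D_(e j) f (p j + t *: e j) - 'D_(e j) f x)).
    move=> t /tb/pbox/dU[Up _]; apply: is_deriveB.
      by apply: is_derive_line; exact: Ck_is_derive fC Up.
    exact: is_derive_mulr.
  by move=> t /tb/pbox/dU[_]; exact.
have -> : f (h + x) - f x - grad_dot h =
    \sum_(j < n) (f (p j.+1) - f (p j) - h 0 j * 'D_(e j) f x).
  rewrite [RHS]big_split/= sumrN -/(grad_dot h); congr (_ - _).
  rewrite -(big_mkord xpredT (fun j => f (p j.+1) - f (p j))) telescope_sumr//.
  congr (f _ - f _); rewrite /p.
    by rewrite addrC; congr (_ + _); apply/rowP => i; rewrite !mxE ltn_ord.
  rewrite (_ : \row__ _ = 0) ?addr0//; apply/rowP => i; by rewrite !mxE.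
apply: le_trans (ler_norm_sum _ _ _) _.
apply: le_trans (ler_sum _ (fun j _ => step j)) _.
rewrite sumr_const card_ord -[leLHS]mulr_natr (mulrAC (eps / _)).
apply: ler_wpM2r => //.
by rewrite -mulrA ler_piMr ?(ltW eps0)// mulrC ler_pdivrMr// mul1r ler_nat.
Qed.

Lemma grad_dot_continuous : continuous (grad_dot : 'rV[R]_n -> R).
Proof.
move=> u; rewrite /grad_dot.
have : Ck setT 0 (fun h : 'rV[R]_n => \sum_(j < n) h 0 j * 'D_(e j) f x).
  apply: Ck_sum => [|j]; first exact: openT.
  by apply: Ck_mul; [exact: openT|apply: Ck_coord; exact: openT|exact: Ck_cst].
by move=> /Ck_continuous; apply.
Qed.

Lemma C1_differentiable (U : set 'rV[R]_n) : open U -> Ck U 1 f -> U x ->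
  differentiable f x /\ forall h, 'd f x h = grad_dot h.
Proof.
move=> oU fC Ux; have gc := grad_dot_continuous.
have [fd dE] := diff_increment gc (C1_increment oU fC Ux).
by split=> // h; rewrite dE.
Qed.

End C1.

(** Only the directional derivative of p along v is assumed; restricting p to
    the line through x makes it differentiable as a function of one variable. *)
Lemma is_derive_comp_rV (V : normedModType R) m (U : set 'rV[R]_m) (f : 'rV[R]_m -> R)
    (p : V -> 'rV[R]_m) (dp : 'rV[R]_m) (x v : V) :
  open U -> Ck U 1 f -> U (p x) ->
  (forall j, is_derive x v (fun u => p u 0 j) (dp 0 j)) ->
  is_derive x v (f \o p) (\sum_(j < m) 'D_(e j) f (p x) * dp 0 j).
Proof.
move=> oU fC Upx pd.
have pdr : derivable p x v.
  by apply/derivable_mxP => i j; rewrite ord1; have [] := pd j.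
have dpE : 'D_v p x = dp.
  rewrite derive_mx//; apply/rowP => j; rewrite mxE.
  by rewrite (@derive_val _ _ _ _ _ _ _ (pd j)).
have [fd fE] := C1_differentiable oU fC Upx.
pose q (t : R) := p (x + t *: v).
have q0 : q 0 = p x by rewrite /q scale0r addr0.
have qd : is_derive (0 : R) 1 q dp.
  have E : (fun h : R => h^-1 *: ((q \o shift 0) (h *: 1) - q 0)) =
           (fun h => h^-1 *: ((p \o shift x) (h *: v) - p x)).
    apply/funext => h /=; rewrite q0 /q addr0 -[h *: 1]/(h * 1) mulr1.
    by rewrite [x + _]addrC.
  by split; rewrite /derivable /derive E.
have [qdr qE] := qd.
have qdi : differentiable q 0 by apply/derivable1_diffP.
rewrite -q0 in fd fE.
have := differentiable_comp qdi fd => /derivable1_diffP fqd.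
have : is_derive (0 : R) 1 (f \o q) (\sum_(j < m) 'D_(e j) f (p x) * dp 0 j).
  split => //; rewrite deriveE; last exact/derivable1_diffP.
  have qE1 : 'd q 0 1 = dp by rewrite -deriveE.
  rewrite diff_comp//= qE1 fE /grad_dot q0.
  by apply: eq_bigr => j _; rewrite mulrC.
have E : (fun h : R => h^-1 *: (((f \o q) \o shift 0) (h *: 1) - (f \o q) 0)) =
           (fun h => h^-1 *: (((f \o p) \o shift x) (h *: v) - (f \o p) x)).
  apply/funext => h /=; rewrite q0 /q addr0 -[h *: 1]/(h * 1) mulr1.
  by rewrite [x + _]addrC.
by move=> []; rewrite /derivable /derive E => ? ?; split.
Qed.

Lemma Ck_comp n m (U : set 'rV[R]_n) (V : set 'rV[R]_m) k (f : 'rV[R]_m -> R)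
    (p : 'rV[R]_n -> 'rV[R]_m) : open U -> open V ->
  Ck V k f -> (forall j, Ck U k (fun u => p u 0 j)) ->
  (forall u, U u -> V (p u)) -> Ck U k (f \o p).
Proof.
move=> oU oV + + pUV; elim: k f => [|k IH] f fC pC.
  split=> // x Ux; apply: continuous_comp; last exact: (Ck_continuous fC (pUV _ Ux)).
  by apply: continuous_coords => j; exact: (Ck_continuous (pC j) Ux).
apply: (@Ck_deriv _ _ _ _ _ (fun i x => \sum_(j < m) 'D_(e j) f (p x) *
    (\row_j 'D_(e i) (fun u => p u 0 j) x) 0 j)) => //.
- move=> x Ux; apply: continuous_comp; last exact: (Ck_continuous fC (pUV _ Ux)).
  by apply: continuous_coords => j; exact: (Ck_continuous (pC j) Ux).
- move=> i x Ux; apply: (is_derive_comp_rV oV _ (pUV _ Ux)).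
    by elim: k fC {IH pC} => // k IH /CkW.
  by move=> j; rewrite mxE; exact: (Ck_is_derive i (pC j) Ux).
- move=> i; apply: Ck_sum => // j.
  apply: Ck_mul => //; first exact: (IH _ (Ck_partial j fC) (fun j => CkW (pC j))).
  under eq_fun do rewrite mxE; exact: (Ck_partial i (pC j)).
Qed.

Lemma smooth_on_comp n m (U : set 'rV[R]_n) (V : set 'rV[R]_m) (f : 'rV[R]_m -> R)
    (p : 'rV[R]_n -> 'rV[R]_m) : open U -> open V ->
  smooth_on V f -> (forall j, smooth_on U (fun u => p u 0 j)) ->
  (forall u, U u -> V (p u)) -> smooth_on U (f \o p).
Proof.
move=> oU oV /smooth_onP fC pC pUV; apply/smooth_onP => k.
by apply: (Ck_comp oU oV (fC k)) => // j; move/smooth_onP: (pC j); exact.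
Qed.

Section SmoothOps.
Variables (n : nat) (U : set 'rV[R]_n).
Hypothesis oU : open U.
Implicit Types f g : 'rV[R]_n -> R.

Lemma smooth_on_cst c : smooth_on U (cst c).
Proof. by apply/smooth_onP => k; exact: Ck_cst. Qed.

Lemma smooth_on_coord j : smooth_on U (fun x => x 0 j).
Proof. by apply/smooth_onP => k; exact: Ck_coord. Qed.

Lemma smooth_on_add f g :
  smooth_on U f -> smooth_on U g -> smooth_on U (fun x => f x + g x).
Proof.
by move=> /smooth_onP fC /smooth_onP gC; apply/smooth_onP => k; exact: Ck_add.
Qed.

Lemma smooth_on_mul f g :
  smooth_on U f -> smooth_on U g -> smooth_on U (fun x => f x * g x).
Proof.
by move=> /smooth_onP fC /smooth_onP gC; apply/smooth_onP => k; exact: Ck_mul.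
Qed.

Lemma smooth_on_inv f : (forall x, U x -> f x != 0) ->
  smooth_on U f -> smooth_on U (fun x => (f x)^-1).
Proof.
by move=> f0 /smooth_onP fC; apply/smooth_onP => k; exact: Ck_inv.
Qed.

Lemma smooth_on_sum (I : Type) (r : seq I) (F : I -> 'rV[R]_n -> R) :
  (forall i, smooth_on U (F i)) -> smooth_on U (fun x => \sum_(i <- r) F i x).
Proof.
by move=> FC; apply/smooth_onP => k; apply: Ck_sum => // i; exact: ((smooth_onP U (F i)).1 (FC i)).
Qed.

Lemma smooth_on_prod (I : Type) (r : seq I) (F : I -> 'rV[R]_n -> R) :
  (forall i, smooth_on U (F i)) -> smooth_on U (fun x => \prod_(i <- r) F i x).
Proof.
by move=> FC; apply/smooth_onP => k; apply: Ck_prod => // i; exact: ((smooth_onP U (F i)).1 (FC i)).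
Qed.

End SmoothOps.

Lemma smooth_on_sub n (U V : set 'rV[R]_n) f :
  V `<=` U -> smooth_on U f -> smooth_on V f.
Proof. by move=> VU fs s x /VU; exact: fs. Qed.

Lemma smooth_on_local n (U : set 'rV[R]_n) f :
  (forall x, U x -> exists V g, [/\ open V, V x, smooth_on V g & {in V, f =1 g}]) ->
  smooth_on U f.
Proof.
move=> loc s x Ux; have [V [g [oV Vx gs fg]]] := loc x Ux.
by apply: (smooth_on_ext oV _ gs) => // y /fg ->.
Qed.

End Chain.

(** * Smooth bumps of one variable *)

Section Bump.
Context {R : realType}.

(** For p = 1 this is exp (-1/t) extended by 0; the polynomial factor makes the
    family stable under differentiation. *)
Definition flat (p : {poly R}) (t : R) : R :=
  if 0 < t then p.[t^-1] * expR (- t^-1) else 0.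

Lemma horner_bound (p : {poly R}) :
  exists2 C, 0 <= C & forall u, 1 <= u -> `|p.[u]| <= C * u ^+ size p.
Proof.
exists (\sum_(i < size p) `|p`_i|) => [|u u1]; first exact: sumr_ge0.
rewrite horner_coef mulr_suml; apply: le_trans (ler_norm_sum _ _ _) _.
apply: ler_sum => i _; rewrite normrM normrX ler_wpM2l// ger0_norm; last lra.
by apply: ler_weXn2l => //; exact: ltnW.
Qed.

(** exp u dominates u^(N+1) / (N+1)!, applied to u = 1 / h. *)
Lemma flat_bound (p : {poly R}) :
  exists C, forall h, `|h| <= 1 -> `|flat p h| <= C * `|h|.
Proof.
have [C C0 pC] := horner_bound p; set N := size p in pC.
exists (C * N.+1`!%:R) => h; rewrite /flat; case: ifPn => [h0|_ _]; last first.
  by rewrite normr0 mulr_ge0// mulr_ge0.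
rewrite gtr0_norm// => h1.
have u1 : 1 <= h^-1 by rewrite -(invr1 R) lef_pV2 ?posrE.
have u0 : 0 < h^-1 by rewrite invr_gt0.
rewrite normrM (ger0_norm (expR_ge0 _)) expRN.
have := expR_ge1Dxn N (ltW u0); set E := expR _ => EN.
have f0 : 0 < N.+1`!%:R :> R by rewrite ltr0n fact_gt0.
have E0 : 0 < E by rewrite expR_gt0.
rewrite ler_pdivrMr//; apply: le_trans (pC _ u1) _.
have : h^-1 ^+ N.+1 / N.+1`!%:R <= E by apply: le_trans EN; rewrite lerDr.
rewrite ler_pdivrMr// => EN'.
have -> : h^-1 ^+ N = h * h^-1 ^+ N.+1.
  by rewrite exprS mulrA mulfV ?mul1r// gt_eqF.
rewrite -2!(mulrA C) ler_wpM2l// [leRHS](_ : _ = h * (E * N.+1`!%:R)); last by ring.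
by rewrite ler_wpM2l// ltW.
Qed.

(** At t = 0 the difference quotient of [flat p] is [flat (p * 'X)], so the bound
    [flat_bound] applies to it. *)
Lemma is_derive_flat (p : {poly R}) (t : R) :
  is_derive t 1 (flat p) (flat ('X ^+ 2 * (p - p^`())) t).
Proof.
have [t0|t0|<-] := ltrgtP 0 t.
- have tn0 : t != 0 by rewrite gt_eqF.
  have nt : \forall s \near t, p.[s^-1] * expR (- s^-1) = flat p s.
    have : \forall s \near t, 0 < s by exact: lt_nbhsr.
    by apply: filterS => s s0; rewrite /flat s0.
  apply: (near_eq_is_derive nt); rewrite /flat t0.
  have dv : is_derive t 1 (fun s : R => s^-1) (- t ^- 2).
    apply: is_derive_eq (is_deriveV tn0 (is_derive_id t 1)) _.
    by rewrite -[LHS]/(_ * _) mulr1.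
  have dvN : is_derive t 1 (fun s : R => - s^-1) (t ^- 2).
    by apply: is_derive_eq (is_deriveN dv) _; rewrite opprK.
  have dp : is_derive t 1 (fun s : R => p.[s^-1]) (- t ^- 2 * (p^`()).[t^-1]).
    by apply: is_derive_eq (is_derive1_comp (is_derive_poly p t^-1) dv) _; rewrite mulrC.
  have de : is_derive t 1 (fun s : R => expR (- s^-1)) (t ^- 2 * expR (- t^-1)).
    have := @is_derive1_comp _ expR (fun s : R => - s^-1) t _ _ (is_derive_expR (- t^-1)) dvN.
    by rewrite mulrC.
  apply: is_derive_eq (is_deriveM dp de) _.
  rewrite !hornerE -[_ *: _]/(_ * _) -[X in _ + X]/(_ * _) -exprVn.
  ring.
- have nt : \forall s \near t, 0 = flat p s.
    have : \forall s \near t, s < 0 by exact: lt_nbhsl.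
    by apply: filterS => s s0; rewrite /flat ltNge (ltW s0).
  apply: (near_eq_is_derive nt); rewrite /flat ltNge (ltW t0) /=.
  exact: is_derive_cst.
- rewrite [in X in is_derive _ _ _ X]/flat ltxx.
  have [C Cp] := flat_bound (p * 'X).
  have q0 : (fun h : R => h^-1 *: ((flat p \o shift 0) (h *: 1) - flat p 0)) @ 0^' --> (0 : R).
    apply/cvgrPdist_le => eps eps0; near=> h.
    have hn0 : h != 0 by near: h; exact: nbhs_dnbhs_neq.
    rewrite sub0r normrN /= addr0 -[h *: 1]/(h * 1) mulr1 [flat p 0]/flat ltxx subr0.
    have -> : h^-1 *: flat p h = flat (p * 'X) h.
      rewrite /flat; case: ifPn => _; last by rewrite scaler0.
      by rewrite hornerMX -[_ *: _]/(_ * _); ring.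
    apply: le_trans (Cp _ _) _; first by near: h; apply: dnbhs0_le.
    apply: (@le_trans _ _ (`|C| * `|h|)); first by rewrite ler_wpM2r// ler_norm.
    apply: (@le_trans _ _ ((`|C| + 1) * `|h|)); first by rewrite ler_wpM2r// lerDl.
    rewrite mulrC -ler_pdivlMr; last by rewrite ltr_wpDl.
    by near: h; apply: dnbhs0_le; rewrite divr_gt0// ltr_wpDl.
  by split; [apply/cvg_ex; exists 0|exact/cvg_lim].
Unshelve. all: by end_near. Qed.

Lemma is_derive_comp1 (V : normedModType R) (f : R -> R) (p : V -> R) (x v : V) (a d : R) :
  is_derive x v p d -> is_derive (p x) 1 f a -> is_derive x v (f \o p) (a * d).
Proof.
have x0 : x = x + 0 *: v by rewrite scale0r addr0.
move=> pd fd; rewrite x0 in pd fd.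
rewrite x0; apply: line_is_derive.
exact: is_derive1_comp fd (is_derive_line pd).
Qed.

(** Carrying the successive derivatives along, rather than an iterated
    derivative operator, gives direct access to their values and supports. *)
Definition derivative_family (u : nat -> R -> R) :=
  forall (k : nat) (t : R), is_derive t (1 : R) (u k) (u k.+1 t).

Lemma derivative_family_continuous u k : derivative_family u -> continuous (u k).
Proof.
move=> ud t; apply/differentiable_continuous/derivable1_diffP.
by have [] := ud k t.
Qed.

Lemma Ck_family n (U : set 'rV[R]_n) k (u : nat -> R -> R) (p : 'rV[R]_n -> R) j :
  open U -> derivative_family u -> Ck U k p -> Ck U k (u j \o p).
Proof.
move=> oU ud; elim: k j => [|k IH] j pC.
  split=> // x Ux; apply: continuous_comp (Ck_continuous pC Ux) _.
  exact: derivative_family_continuous.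
apply: (@Ck_deriv _ _ _ _ _ (fun i x => 'D_(delta_mx 0 i) p x * u j.+1 (p x))) => //.
- move=> x Ux; apply: continuous_comp (Ck_continuous pC Ux) _.
  exact: derivative_family_continuous.
- move=> i x Ux; rewrite mulrC; apply: is_derive_comp1; last exact: ud.
  exact: (Ck_is_derive i pC Ux).
- move=> i; apply: Ck_mul => //; first exact: Ck_partial.
  exact/IH/CkW.
Qed.

Lemma smooth_on_family n (U : set 'rV[R]_n) (u : nat -> R -> R) (p : 'rV[R]_n -> R) j :
  open U -> derivative_family u -> smooth_on U p -> smooth_on U (u j \o p).
Proof.
move=> oU ud /smooth_onP pC; apply/smooth_onP => k; exact: Ck_family.
Qed.

Lemma smooth_derivative_family (F : 'rV[R]_1 -> R) : smooth_on setT F ->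
  exists2 u, derivative_family u & forall t, u 0%N t = F (t *: delta_mx 0 0).
Proof.
move=> Fs; exists (fun k t => iter_partial F (nseq k 0) (t *: delta_mx 0 0)) => // k t.
have [_ /(_ 0)] := Fs (nseq k 0) (t *: delta_mx 0 0) I.
move=> /derivableP Fd; rewrite -[t *: _]add0r in Fd.
have := is_derive_line Fd; rewrite add0r.
by under [X in is_derive _ _ X _ -> _]eq_fun do rewrite add0r.
Qed.

(** The quotient of f(t) by f(t) + f(1 - t), for f = exp (-1/t). *)
Lemma smooth_step : exists2 u : nat -> R -> R, derivative_family u &
  [/\ forall t, t <= 0 -> u 0%N t = 0, forall t, 1 <= t -> u 0%N t = 1 &
      forall t, 0 <= u 0%N t <= 1].
Proof.
pose fl k := iter k (fun p : {poly R} => 'X ^+ 2 * (p - p^`())) 1.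
have fld : derivative_family (fun k => flat (fl k)) by move=> k t; exact: is_derive_flat.
have f0 t : 0 <= flat (fl 0%N) t.
  by rewrite /flat; case: ifP => // _; rewrite hornerE mul1r expR_ge0.
have fgt0 t : 0 < t -> 0 < flat (fl 0%N) t.
  by move=> t0; rewrite /flat t0 hornerE mul1r expR_gt0.
have fle0 t : t <= 0 -> flat (fl 0%N) t = 0 by move=> t0; rewrite /flat ltNge t0.
pose q t := flat (fl 0%N) t + flat (fl 0%N) (1 - t).
have q0 t : 0 < q t.
  have [t0|t0] := ltP 0 t; first by rewrite ltr_pwDl// fgt0.
  by rewrite ltr_wpDl// fgt0//; lra.
pose F (x : 'rV[R]_1) := flat (fl 0%N) (x 0 0) * (q (x 0 0))^-1.
have Fs : smooth_on setT F.
  have oT : open [set: 'rV[R]_1] by exact: openT.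
  have cs : smooth_on setT (fun x : 'rV[R]_1 => x 0 0) by exact: smooth_on_coord.
  apply: (smooth_on_mul oT); first exact: (smooth_on_family 0 oT fld cs).
  apply: (smooth_on_inv oT); first by move=> x _; rewrite gt_eqF.
  apply: (smooth_on_add oT); first exact: (smooth_on_family 0 oT fld cs).
  apply: (@smooth_on_family _ _ _ (fun x : 'rV[R]_1 => 1 - x 0 0) 0%N oT fld).
  apply: (smooth_on_add oT); first exact: smooth_on_cst.
  rewrite (_ : (fun _ => _) = (fun x : 'rV[R]_1 => -1 * x 0 0)); last first.
    by apply/funext => x; rewrite mulN1r.
  by apply: (smooth_on_mul oT); [exact: smooth_on_cst|exact: cs].
have [u ud u0] := smooth_derivative_family Fs.
have uE t : u 0%N t = flat (fl 0%N) t / q t by rewrite u0 /F !mxE eqxx mulr1.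
exists u => //; split=> t.
- by move=> t0; rewrite uE fle0// mul0r.
- by move=> t1; rewrite uE /q (fle0 (1 - t)) ?subr_le0// addr0 divff// gt_eqF// fgt0//; lra.
- by rewrite uE divr_ge0 ?(ltW (q0 t))//= ler_pdivrMr// mul1r lerDl.
Qed.

(** Vanishing outside [-1, 1] propagates to the derivatives, which are continuous
    and so bounded on the compact interval. *)
Lemma derivative_family_bounded u : derivative_family u ->
  (forall t, 1 <= `|t| -> u 0%N t = 0) ->
  forall k, exists B, forall t, `|u k t| <= B.
Proof.
move=> ud u0 k.
have uk0 t : 1 < `|t| -> u k t = 0.
  elim: k t => [|k IH] t t1; first by rewrite u0// ltW.
  have nt : \forall s \near t, 0 = u k s.
    have : \forall s \near t, 1 < `|s|.
      apply: (@cvgr_gt R R (nbhs t) _ (fun s => `|s|) `|t| _ 1 t1).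
      exact: norm_continuous.
    by apply: filterS => s /IH.
  have [_ <-] := ud k t; have [_] := near_eq_is_derive nt (is_derive_cst 0 t 1).
  by [].
have cu := @derivative_family_continuous u k ud.
have [c _ cM] := @EVT_max R (fun t => `|u k t|) (-1) 1 (ltac:(lra))
  (continuous_subspaceT (fun t => continuous_comp (cu t) (@norm_continuous _ _ (u k t)))).
exists `|u k c| => t; have [t1|t1] := leP `|t| 1; last by rewrite uk0 ?normr0.
by apply: cM; rewrite in_itv/= -ler_norml.
Qed.

(** With theta the smooth step, theta(1 + t) - theta(t) has support in [-1, 1] and
    its integer translates telescope to 1. *)
Lemma bump_partition : exists2 b : nat -> R -> R, derivative_family b &
  [/\ forall t, 0 <= b 0%N t <= 1, b 0%N 0 = 1, forall t, 1 <= `|t| -> b 0%N t = 0,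
      forall (K : nat) t, `|t| <= K%:R -> \sum_(i < K.*2.+1) b 0%N (t + K%:R - i%:R) = 1 &
      forall k, exists B, forall t, `|b k t| <= B].
Proof.
have [u ud [ul ur u01]] := smooth_step.
pose b k t := u k (1 + t) - u k t.
have bd : derivative_family b.
  move=> k t; apply: is_deriveB; last exact: ud.
  have d1 : is_derive t (1 : R) (fun t : R => 1 + t) 1.
    by have := is_deriveD (is_derive_cst (1 : R) t (1 : R)) (is_derive_id t (1 : R)); rewrite add0r.
  by have := is_derive_comp1 d1 (ud k (1 + t)); rewrite mulr1.
have bz t : 1 <= `|t| -> b 0%N t = 0.
  rewrite /b; have [t0|t0] := leP 0 t.
    by rewrite ger0_norm// => t1; rewrite !ur ?subrr//; lra.
  by rewrite ltr0_norm// => t1; rewrite !ul ?subrr//; lra.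
exists b => //; split=> //.
- move=> t; rewrite /b; have [t0|t0] := leP 0 t.
    by rewrite ur; [have := u01 t; lra|lra].
  by rewrite (ul t) ?subr0//; exact: ltW.
- by rewrite /b addr0 ur// ul// subr0.
- move=> K t; rewrite ler_norml => /andP[t1 t2].
  rewrite -(big_mkord xpredT (fun i => b 0%N (t + K%:R - i%:R))).
  rewrite (eq_big_nat _ _ (F2 := fun i => - u 0%N (1 + (t + K%:R - i.+1%:R)) - - u 0%N (1 + (t + K%:R - i%:R)))).
    rewrite (telescope_sumr (fun i => - u 0%N (1 + (t + K%:R - i%:R))))// opprK.
    rewrite (ul (1 + (t + K%:R - (K.*2.+1)%:R))); last first.
      by rewrite -addn1 -addnn !natrD; lra.
    by rewrite oppr0 add0r ur//; lra.
  move=> i _; rewrite opprK [RHS]addrC /b; congr (_ - u _ _).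
  by rewrite -natr1; lra.
- exact: derivative_family_bounded.
Qed.

End Bump.

(** * Series of smooth functions *)

Section Series.
Context {R : realType}.
Local Notation e i := (delta_mx 0 i : 'rV[R]_ _).

Lemma cvg_of_rate (u r : nat -> R) (N0 : nat) :
  (forall N M, (N0 <= N <= M)%N -> `|u M - u N| <= r N) -> r @ \oo --> (0 : R) ->
  exists l : R, u @ \oo --> l /\ forall N, (N0 <= N)%N -> `|l - u N| <= r N.
Proof.
move=> ur r0.
have cu : cauchy (u @ \oo).
  apply: cauchy_exP => eps eps0.
  have : \forall N \near \oo, r N < eps by exact: (cvgr_lt _ r0).
  move=> rn; have : \forall N \near \oo, r N < eps /\ (N0 <= N)%N.
    by apply: filterI => //; exact: nbhs_infty_ge.
  move=> /filter_ex[N [rN NN]]; exists (u N).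
  rewrite /fmap /=; near=> M; apply: le_lt_trans rN.
  rewrite distrC; apply: ur; rewrite NN /=; near: M; exact: nbhs_infty_ge.
have /cauchy_cvgP/cvg_ex[/= l ul] := cu.
exists l; split=> // N NN.
have cd : (fun M => `|u M - u N|) @ \oo --> `|l - u N|.
  by apply: cvg_norm; apply: cvgB => //; exact: cvg_cst.
rewrite -(cvg_lim (@Rhausdorff R) cd).
apply: limr_le; first by apply/cvg_ex; exists `|l - u N|.
by near=> M; apply: ur; rewrite NN /=; near: M; exact: nbhs_infty_ge.
Unshelve. all: by end_near. Qed.

(** The mean value inequality bounds the increments of F M - F N uniformly in M;
    letting M tend to infinity bounds those of G - F N. *)
Lemma is_derive_limit (V : normedModType R) (F dF : nat -> V -> R) (G : V -> R)
    (d : R) (x v : V) (r : nat -> R) (N0 : nat) :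
  (forall N y, is_derive y v (F N) (dF N y)) ->
  (forall y, F ^~ y @ \oo --> G y) ->
  (forall N M y, (N0 <= N <= M)%N -> `|dF M y - dF N y| <= r N) ->
  (forall N, (N0 <= N)%N -> `|d - dF N x| <= r N) ->
  r @ \oo --> (0 : R) ->
  is_derive x v G d.
Proof.
move=> Fd FG dFr dr r0.
have diffG N t : (N0 <= N)%N ->
    `|(G (x + t *: v) - F N (x + t *: v)) - (G x - F N x)| <= r N * `|t|.
  move=> NN.
  have cd : (fun M => `|(F M (x + t *: v) - F N (x + t *: v)) - (F M x - F N x)|) @ \oo -->
      `|(G (x + t *: v) - F N (x + t *: v)) - (G x - F N x)|.
    by apply: cvg_norm; apply: cvgB; apply: cvgB => //; exact: cvg_cst.
  rewrite -(cvg_lim (@Rhausdorff R) cd).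
  apply: limr_le; first by apply/cvg_ex; eexists; exact: cd.
  near=> M.
  have NM : (N0 <= N <= M)%N by rewrite NN /=; near: M; exact: nbhs_infty_ge.
  have := @mvt_bound R (fun s => F M (x + s *: v) - F N (x + s *: v))
    (fun s => dF M (x + s *: v) - dF N (x + s *: v)) 0 t (r N).
  rewrite scale0r addr0 subr0; apply=> s _; last exact: dFr.
  by apply: is_deriveB; apply: is_derive_line.
have key : (fun h : R => h^-1 *: ((G \o shift x) (h *: v) - G x)) @ 0^' --> d.
  apply/cvgrPdist_le => eps eps0.
  have e3 : 0 < eps / 3 by rewrite divr_gt0.
  have rn : \forall N \near \oo, r N < eps / 3 by exact: (cvgr_lt _ r0).
  have : \forall N \near \oo, r N < eps / 3 /\ (N0 <= N)%N.
    by apply: filterI => //; exact: nbhs_infty_ge.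
  move=> /filter_ex[N [rN NN]].
  have [FNd FNE] := Fd N x.
  have := FNd; rewrite /derivable => /cvg_ex[l fl].
  have lE : l = dF N x by rewrite -FNE; apply/esym/cvg_lim.
  have := fl; rewrite lE => /cvgrPdist_le/(_ _ e3) fN.
  near=> h.
  have hn0 : h != 0 by near: h; exact: nbhs_dnbhs_neq.
  have h1 : `|dF N x - h^-1 *: ((F N \o shift x) (h *: v) - F N x)| <= eps / 3.
    by near: h.
  have h2 := dr N NN; have h3 := diffG N h NN.
  have -> : d - h^-1 *: ((G \o shift x) (h *: v) - G x) =
     (d - dF N x) + (dF N x - h^-1 *: ((F N \o shift x) (h *: v) - F N x))
     - h^-1 * ((G (x + h *: v) - F N (x + h *: v)) - (G x - F N x)).
    by rewrite /= [x + _]addrC -![_ *: (_ - _)]/(_ * _); ring.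
  apply: le_trans (ler_normB _ _) _.
  have h4 : `|h^-1 * ((G (x + h *: v) - F N (x + h *: v)) - (G x - F N x))| <= r N.
    rewrite normrM normfV mulrC ler_pdivrMr ?normr_gt0//.
  have := ler_normD (d - dF N x) (dF N x - h^-1 *: ((F N \o shift x) (h *: v) - F N x)).
  lra.
by split; [apply/cvg_ex; exists d|exact/cvg_lim].
Unshelve. all: by end_near. Qed.

Lemma continuous_uniform_limit (T : topologicalType) (F : nat -> T -> R) (G : T -> R)
    (x : T) (r : nat -> R) (N0 : nat) :
  (forall N, {for x, continuous (F N)}) ->
  (forall N y, (N0 <= N)%N -> `|G y - F N y| <= r N) ->
  r @ \oo --> (0 : R) -> {for x, continuous G}.
Proof.
move=> Fc GF r0; apply/cvgrPdist_le => eps eps0.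
have e3 : 0 < eps / 3 by rewrite divr_gt0.
have rn : \forall N \near \oo, r N < eps / 3 by exact: (cvgr_lt _ r0).
have : \forall N \near \oo, r N < eps / 3 /\ (N0 <= N)%N.
  by apply: filterI => //; exact: nbhs_infty_ge.
move=> /filter_ex[N [rN NN]].
have /cvgrPdist_le/(_ _ e3) := Fc N.
apply: filterS => y h1; have h2 := GF N x NN; have h3 := GF N y NN.
rewrite distrC in h3.
have -> : G x - G y = (G x - F N x) + (F N x - F N y) + (F N y - G y) by ring.
apply: le_trans (ler_normD _ _) _.
have := ler_normD (G x - F N x) (F N x - F N y); lra.
Qed.

Lemma cvg_half_pow (c : R) : (fun N : nat => c / 2 ^+ N) @ \oo --> (0 : R).
Proof.
rewrite (_ : (fun N : nat => _) = geometric c (2^-1)); last first.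
  by apply/funext => N; rewrite /geometric/= exprVn.
by apply: cvg_geometric; rewrite ger0_norm// ?invr_ge0// invf_lt1// ltr1n.
Qed.

Lemma iter_partial_add n (U : set 'rV[R]_n) (f g : 'rV[R]_n -> R) s : open U ->
  smooth_on U f -> smooth_on U g -> {in U, iter_partial (fun x => f x + g x) s =1
    fun x => iter_partial f s x + iter_partial g s x}.
Proof.
move=> oU fs gs; elim: s => [//|i s IH] x /set_mem Ux /=.
rewrite (near_eq_derive _ (near_open_eq oU IH Ux)).
by rewrite deriveD//; [have [_] := fs s x Ux|have [_] := gs s x Ux]; exact.
Qed.

Lemma iter_partial_cst n c s (x : 'rV[R]_n) :
  iter_partial (cst c) s x = if s is [::] then c else 0.
Proof.
elim: s x => [//|i s IH] x /=.
rewrite (_ : iter_partial _ _ = cst (if s is [::] then c else 0)) ?derive_cst//.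
by apply/funext => y; rewrite IH.
Qed.

Lemma iter_partial_sum n (U : set 'rV[R]_n) (I : Type) (r : seq I)
    (F : I -> 'rV[R]_n -> R) s : open U -> (forall i, smooth_on U (F i)) ->
  {in U, iter_partial (fun x => \sum_(i <- r) F i x) s =1
    fun x => \sum_(i <- r) iter_partial (F i) s x}.
Proof.
move=> oU FC; elim: r => [|a r IH] x xU.
  rewrite big_nil (_ : (fun _ => _) = cst 0); last by apply/funext => y; rewrite big_nil.
  by rewrite iter_partial_cst; case: s.
under eq_fun do rewrite big_cons.
rewrite (@iter_partial_add _ U)//; first by rewrite IH// big_cons.
exact: smooth_on_sum.
Qed.

Lemma iter_partial_scale n (U : set 'rV[R]_n) (c : R) f s : open U -> smooth_on U f ->
  {in U, iter_partial (fun x => c * f x) s =1 fun x => c * iter_partial f s x}.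
Proof.
move=> oU fs; elim: s => [//|i s IH] x /set_mem Ux /=.
rewrite (near_eq_derive _ (near_open_eq oU IH Ux)).
rewrite -[LHS]/('D_(e i) (c \*: iter_partial f s) x) deriveZ//.
by have [_] := fs s x Ux; exact.
Qed.

Lemma translate_growth_rate n (f : 'rV[R]_n -> R) (a v x : 'rV[R]_n) :
  (fun h : R => h^-1 *: (((fun y => f (y + a)) \o shift x) (h *: v) - f (x + a))) =
  (fun h => h^-1 *: ((f \o shift (x + a)) (h *: v) - f (x + a))).
Proof. by apply/funext => h /=; rewrite addrA. Qed.

Lemma derive_translate n (f : 'rV[R]_n -> R) (a v x : 'rV[R]_n) :
  'D_v (fun y => f (y + a)) x = 'D_v f (x + a).
Proof.
by rewrite /derive translate_growth_rate.
Qed.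

Lemma iter_partial_translate n (f : 'rV[R]_n -> R) (a : 'rV[R]_n) s :
  iter_partial (fun y => f (y + a)) s = fun y => iter_partial f s (y + a).
Proof.
elim: s => [//|i s IH]; apply/funext => x.
by rewrite /= IH derive_translate.
Qed.

Lemma smooth_on_translate n (U : set 'rV[R]_n) (f : 'rV[R]_n -> R) (a : 'rV[R]_n) :
  smooth_on U f -> smooth_on [set y | U (y + a)] (fun y => f (y + a)).
Proof.
move=> fs s x Ux; rewrite iter_partial_translate; have [fc fd] := fs s _ Ux.
split=> [|i].
  apply: (@continuous_comp _ _ _ (fun y : 'rV[R]_n => y + a) (iter_partial f s) x _ fc).
  apply: (@continuousD _ _ _ id (cst a) x); first by move=> ?; exact.
  exact: cst_continuous.
by rewrite /derivable translate_growth_rate; exact: fd.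
Qed.

(** Each derivative of the partial sums converges uniformly, at the rate of a
    geometric series; the limits are then derivatives of one another. *)
Theorem smooth_series n (f : nat -> 'rV[R]_n -> R) :
  (forall i, smooth_on setT (f i)) ->
  (forall s, exists c i0, forall i x, (i0 <= i)%N -> `|iter_partial (f i) s x| <= c / 2 ^+ i) ->
  exists2 g, smooth_on setT g &
    forall x, (fun N : nat => \sum_(i < N) f i x) @ \oo --> g x.
Proof.
move=> fs fK.
pose F s N x := \sum_(i < N) iter_partial (f i) s x.
have FE s N : iter_partial (F [::] N) s = F s N.
  by apply/funext => x; exact: (@iter_partial_sum _ setT _ _ (fun i : 'I_N => f i) s openT (fun i => fs i) x (mem_set I)).
have Fs N : smooth_on setT (F [::] N).
  exact: (@smooth_on_sum _ _ setT openT _ _ (fun i : 'I_N => f i)).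
have rate s : exists c i0, forall x N M, (i0 <= N <= M)%N -> `|F s M x - F s N x| <= c / 2 ^+ N.
  have [c [i0 cP]] := fK s; exists (2 * c), i0 => x N M /andP[iN NM].
  have c0 : 0 <= c.
    have := le_trans (normr_ge0 _) (cP i0 x (leqnn _)).
    by rewrite pmulr_lge0// invr_gt0 exprn_gt0.
  have step : `|F s M x - F s N x| <= 2 * c / 2 ^+ N - 2 * c / 2 ^+ M.
    elim: M NM => [|M IH]; first by rewrite leqn0 => /eqP->; rewrite !subrr normr0.
    rewrite leq_eqVlt => /orP[/eqP->|NM]; first by rewrite !subrr normr0.
    rewrite ltnS in NM; rewrite /F big_ord_recr /= -/(F s M x) addrAC.
    apply: le_trans (ler_normD _ _) _.
    have := IH NM; have := cP M x (leq_trans iN NM).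
    have -> : 2 * c / 2 ^+ M.+1 = c / 2 ^+ M by rewrite exprS invfM; field; rewrite expf_neq0.
    have -> : 2 * c / 2 ^+ M = 2 * (c / 2 ^+ M) by rewrite mulrA.
    lra.
  apply: le_trans step _; rewrite gerBl.
  by rewrite divr_ge0 ?mulr_ge0// exprn_ge0.
have lims s : exists G : 'rV[R]_n -> R, exists c i0, [/\ forall x, F s ^~ x @ \oo --> G x,
    forall x N, (i0 <= N)%N -> `|G x - F s N x| <= c / 2 ^+ N &
    forall x N M, (i0 <= N <= M)%N -> `|F s M x - F s N x| <= c / 2 ^+ N].
  have [c [i0 cP]] := rate s.
  have ex x : exists l : R, F s ^~ x @ \oo --> l /\
      forall N, (i0 <= N)%N -> `|l - F s N x| <= c / 2 ^+ N.
    by apply: (cvg_of_rate (r := fun N => c / 2 ^+ N)) => [N M|]; [exact: cP|exact: cvg_half_pow].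
  have [G GP] := choice ex.
  by exists G, c, i0; split => // x; have [] := GP x.
have [G GP] := choice lims.
have Gc s x : {for x, continuous (G s)}.
  have [c [i0 [_ Gr _]]] := GP s.
  apply: (@continuous_uniform_limit _ (F s) _ _ (fun N => c / 2 ^+ N) i0) => //.
  - by move=> N; rewrite -FE; have [] := Fs N s x I.
  - by move=> N y; exact: Gr.
  - exact: cvg_half_pow.
have Gd s i x : is_derive x (e i) (G s) (G (i :: s) x).
  have [_ [_ [GF _ _]]] := GP s; have [c [i0 [_ Gr Fr]]] := GP (i :: s).
  apply: (@is_derive_limit _ (F s) (F (i :: s)) _ _ _ _ (fun N => c / 2 ^+ N) i0) => //.
    move=> N y; rewrite -(FE (i :: s)) -(FE s) /=; apply: derivableP.
    by have [_] := Fs N s y I; exact.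
  - by move=> N M y; exact: Fr.
  - by move=> N; exact: Gr.
  - exact: cvg_half_pow.
have GE s : iter_partial (G [::]) s = G s.
  elim: s => [//|i s IH]; apply/funext => x; rewrite /= IH.
  by have [] := Gd s i x.
exists (G [::]) => [s x _|x]; last by have [c [i0 [GF _ _]]] := GP [::]; exact: GF.
by rewrite GE; split=> // i; have [] := Gd s i x.
Qed.

End Series.

(** * Cutoffs with polynomially bounded derivatives *)

Section Cutoff.
Context {R : realType}.
Local Notation e i := (delta_mx 0 i : 'rV[R]_ _).

Lemma size_index_enum (T : finType) : size (index_enum T) = #|T|.
Proof. by rewrite cardT enumT /index_enum unlock. Qed.

Definition bounded_partials n (U : set 'rV[R]_n) (m : nat) (K : R) (f : 'rV[R]_n -> R) :=
  forall s, (size s <= m)%N -> forall x, U x -> `|iter_partial f s x| <= K.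

Lemma iter_partial_rcons n (f : 'rV[R]_n -> R) s i :
  iter_partial f (rcons s i) = iter_partial ('D_(e i) f) s.
Proof. by rewrite /iter_partial foldr_rcons. Qed.

Lemma bounded_partialsW n (U : set 'rV[R]_n) m m' K K' f :
  (m <= m')%N -> K' <= K -> bounded_partials U m' K' f -> bounded_partials U m K f.
Proof.
by move=> mm KK fb s sm x Ux; apply: le_trans KK; apply: fb => //; exact: leq_trans mm.
Qed.

(** The Leibniz rule doubles the number of terms at each differentiation, whence
    the factor 2^m. *)
Lemma bounded_partials_mul n (U : set 'rV[R]_n) m K L f g : open U ->
  smooth_on U f -> smooth_on U g -> 0 <= K -> 0 <= L ->
  bounded_partials U m K f -> bounded_partials U m L g ->
  bounded_partials U m (2 ^+ m * (K * L)) (fun x => f x * g x).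
Proof.
move=> oU + + K0 L0; elim: m f g => [|m IH] f g fs gs fb gb s.
  rewrite leqn0 size_eq0 => /eqP-> x Ux; rewrite expr0 mul1r /= normrM.
  by apply: ler_pM => //; [exact: (fb [::])|exact: (gb [::])].
case/lastP: s => [_ x Ux|s i].
  rewrite /= normrM; apply: (@le_trans _ _ (K * L)).
    by apply: ler_pM => //; [exact: (fb [::])|exact: (gb [::])].
  by rewrite ler_peMl ?mulr_ge0// exprn_ege1// ler1n.
rewrite size_rcons ltnS => sm x Ux; rewrite iter_partial_rcons.
have pE : {in U, 'D_(e i) (fun x => f x * g x) =1
    fun x => f x * 'D_(e i) g x + 'D_(e i) f x * g x}.
  move=> y /set_mem Uy; rewrite ['D__ f y * _]mulrC deriveM//.
    by have [_] := fs [::] y Uy; exact.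
  by have [_] := gs [::] y Uy; exact.
rewrite (iter_partial_ext s oU pE (mem_set Ux)).
have dfs := smooth_on_partial i fs; have dgs := smooth_on_partial i gs.
have -> := @iter_partial_add _ _ U _ _ s oU
  (smooth_on_mul oU fs dgs) (smooth_on_mul oU dfs gs) x (mem_set Ux).
apply: le_trans (ler_normD _ _) _.
have fbm : bounded_partials U m K f by exact: bounded_partialsW fb.
have gbm : bounded_partials U m L g by exact: bounded_partialsW gb.
have dfb : bounded_partials U m K ('D_(e i) f).
  by move=> t tm y Uy; rewrite -iter_partial_rcons; apply: fb => //; rewrite size_rcons.
have dgb : bounded_partials U m L ('D_(e i) g).
  by move=> t tm y Uy; rewrite -iter_partial_rcons; apply: gb => //; rewrite size_rcons.
have h1 := IH _ _ fs dgs fbm dgb s sm x Ux.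
have h2 := IH _ _ dfs gs dfb gbm s sm x Ux.
rewrite exprS -mulrA mulr2n mulrDl mul1r; exact: lerD.
Qed.

Lemma bounded_partials_prod n (U : set 'rV[R]_n) m K (I : Type) (r : seq I)
    (F : I -> 'rV[R]_n -> R) : open U ->
  (forall i, smooth_on U (F i)) -> 0 <= K ->
  (forall i, bounded_partials U m K (F i)) ->
  bounded_partials U m ((2 ^+ m * K) ^+ size r) (fun x => \prod_(i <- r) F i x).
Proof.
move=> oU Fs K0 FK; elim: r => [|a r IH].
  rewrite (_ : (fun _ => _) = cst 1); last by apply/funext => x; rewrite big_nil.
  by move=> s _ x _; rewrite iter_partial_cst; case: s; rewrite ?normr1 ?normr0.
under eq_fun do rewrite big_cons.
rewrite exprS -mulrA; apply: bounded_partials_mul => //.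
- by apply: smooth_on_prod.
- by rewrite exprn_ge0// mulr_ge0// exprn_ge0.
Qed.

Lemma bounded_partials_sum n m K (I : Type) (r : seq I) (F : I -> 'rV[R]_n -> R) :
  (forall i, smooth_on setT (F i)) ->
  (forall i, bounded_partials setT m K (F i)) ->
  bounded_partials setT m ((size r)%:R * K) (fun x => \sum_(i <- r) F i x).
Proof.
move=> Fs FK s sm x _; have -> := @iter_partial_sum _ _ setT _ r F s openT Fs x (mem_set Logic.I).
apply: le_trans (ler_norm_sum _ _ _) _.
apply: (@le_trans _ _ (\sum_(i <- r) K)); first by apply: ler_sum => i _; exact: FK.
by rewrite big_const_seq count_predT iter_addr_0 mulr_natl.
Qed.

Lemma smooth_on_affine n (U : set 'rV[R]_n) j (a c : R) : open U ->
  smooth_on U (fun x => x 0 j * a + c).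
Proof.
move=> oU; apply: (smooth_on_add oU); last exact: smooth_on_cst.
by apply: (smooth_on_mul oU); [exact: smooth_on_coord|exact: smooth_on_cst].
Qed.

(** The function depends on the coordinate j only, so that a word of partial
    derivatives containing another index kills it. *)
Lemma iter_partial_scaled n (b : nat -> R -> R) j (a c : R) s (x : 'rV[R]_n) :
  derivative_family b ->
  iter_partial (fun x : 'rV[R]_n => b 0%N (x 0 j * a + c)) s x =
  (all (pred1 j) s)%:R * a ^+ size s * b (size s) (x 0 j * a + c).
Proof.
move=> bd; elim: s x => [|i s IH] x; first by rewrite /= !mul1r.
rewrite /= -/(iter_partial _ s).
rewrite (_ : iter_partial _ s =
   (fun x => (all (pred1 j) s)%:R * a ^+ size s * b (size s) (x 0 j * a + c))); last first.
  by apply/funext => y; rewrite IH.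
set k := size s; set A := _ * _.
have da : is_derive x (e i) (fun x : 'rV[R]_n => x 0 j * a + c) ((i == j)%:R * a).
  have := is_derive_comp1 (is_derive_coord x (e i) j)
    (is_deriveD (is_derive_mulr a (x 0 j)) (is_derive_cst c (x 0 j) (1 : R))).
  by rewrite addr0 mxE eqxx /= mulrC eq_sym.
have db := is_derive_comp1 da (bd k (x 0 j * a + c)).
have [_ dE] := is_deriveM (is_derive_cst A x (e i)) db.
have -> : 'D_(e i) (fun x : 'rV[R]_n => A * b k (x 0 j * a + c)) x =
          A * (b k.+1 (x 0 j * a + c) * ((i == j)%:R * a)).
  rewrite -[LHS]/('D_(e i) (cst A \* (b k \o (fun x : 'rV[R]_n => x 0 j * a + c))) x).
  by rewrite dE scaler0 addr0.
by rewrite /A /k exprS; case: (i == j) => /=; ring.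
Qed.

Lemma family_bound (b : nat -> R -> R) : (forall k, exists B, forall t, `|b k t| <= B) ->
  exists2 B : nat -> R, forall m, 1 <= B m & forall m k t, (k <= m)%N -> `|b k t| <= B m.
Proof.
move=> /choice[B BP]; exists (fun m => 1 + \sum_(k < m.+1) `|B k|) => [m|m k t km].
  by rewrite lerDl sumr_ge0.
apply: le_trans (BP k t) _; apply: le_trans (ler_norm _) _.
rewrite (bigD1 (inord k)) //= inordK// addrCA lerDl addr_ge0// sumr_ge0//.
Qed.

(** Take a partition of unity by products of bumps centred at the points of a
    lattice of mesh rho / 2, and keep the products whose support meets Q.  Their
    number and their derivatives are bounded by powers of 1 / rho.  The exact powers
    do not matter later on, only that they are fixed for each order m. *)
Theorem cutoff_exists n (Q : set 'rV[R]_n) (M : R) : (forall q, Q q -> `|q| <= M) ->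
  exists L P, (forall m : nat, 0 <= L m :> R) /\
  forall rho : R, 0 < rho <= 1 -> exists chi : 'rV[R]_n -> R,
    [/\ smooth_on setT chi, forall q, Q q -> chi q = 1,
        forall x, chi x != 0 -> exists2 q, Q q & `|x - q| <= rho &
        forall m, bounded_partials setT m (L m / rho ^+ P m) chi].
Proof.
move=> QM; have [b bd [b01 _ b0 bsum bB]] := @bump_partition R.
have [B B1 BP] := family_bound bB.
pose M' := Num.max 0 M.
have M'0 : 0 <= M' by rewrite le_max lexx.
have {}QM q : Q q -> `|q| <= M' by move=> /QM qM; rewrite le_max qM orbT.
exists (fun m => (4 * M' + 3) ^+ n * ((2 ^+ m * (B m * 2 ^+ m)) ^+ n)), (fun m => (n + m * n)%N).
split.
  move=> m; rewrite mulr_ge0// exprn_ge0//; first by lra.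
  by rewrite !mulr_ge0 ?exprn_ge0//; have := B1 m; lra.
move=> rho /andP[rho0 rho1].
pose a := 2 / rho; have a0 : 0 < a by rewrite divr_gt0.
have a1 : 1 <= a by rewrite ler_pdivlMr// mul1r; lra.
pose K := (Num.truncn (M' * a)).+1.
have KM : M' * a <= K%:R by apply/ltW/truncnS_gt.
have K1 : K%:R <= M' * a + 1.
  by rewrite -natr1 lerD2r; rewrite truncn_le mulr_ge0// ltW.
pose Z : finType := {ffun 'I_n -> 'I_(K.*2.+1)}.
pose be (z : Z) (x : 'rV[R]_n) := \prod_(j <- index_enum 'I_n) b 0%N (x 0 j * a + (K%:R - (z j)%:R)).
pose near_Q (z : Z) := `[< exists2 q, Q q & forall j, `|q 0 j * a + (K%:R - (z j)%:R)| < 1 >].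
pose r := [seq z <- index_enum Z | near_Q z].
have bes (z : Z) j : smooth_on setT (fun x : 'rV[R]_n => b 0%N (x 0 j * a + (K%:R - (z j)%:R))).
  apply: (@smooth_on_family _ _ _ b (fun x : 'rV[R]_n => x 0 j * a + (K%:R - (z j)%:R))) => //.
    exact: openT.
  by apply: smooth_on_affine; exact: openT.
have bez (z : Z) : smooth_on setT (be z).
  exact: (smooth_on_prod openT (index_enum 'I_n) (bes z)).
exists (fun x => \sum_(z <- r) be z x); split.
- by apply: smooth_on_sum => //; exact: openT.
- move=> q Qq; rewrite big_filter (eq_bigr _ (fun z _ => erefl)) big_mkcond/=.
  transitivity (\sum_(z : Z) be z q).
    apply: eq_bigr => z _; case: ifPn => // /asboolPn nz.
    have [j j1] : exists j, 1 <= `|q 0 j * a + (K%:R - (z j)%:R)|.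
      apply: contrapT => nj; apply: nz; exists q => // j; rewrite ltNge.
      by apply/negP => j1; apply: nj; exists j.
    by apply/esym; rewrite /be (bigD1 j) //= b0// mul0r.
  rewrite -(bigA_distr_bigA (fun j (k : 'I_(K.*2.+1)) => b 0%N (q 0 j * a + (K%:R - k%:R)))).
  rewrite big1// => j _; under eq_bigr do rewrite addrA; apply: bsum.
  rewrite normrM (gtr0_norm a0); apply: le_trans KM.
  by rewrite ler_wpM2r ?(ltW a0)//; apply: le_trans (QM _ Qq); exact: coord_norm_le.
- move=> x xr.
  have [z /andP[zr zx]] : exists z, near_Q z && (be z x != 0).
    apply: contrapT => nz; move/eqP: xr; apply.
    rewrite big_filter big1// => z zr; apply/eqP; apply: contraT => zx.
    by case: nz; exists z; rewrite zr.
  have [q Qq qz] := asboolP _ zr; exists q => //.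
  have x1 j : `|x 0 j * a + (K%:R - (z j)%:R)| < 1.
    rewrite ltNge; apply/negP => j1; move/eqP: zx; apply.
    by rewrite /be (bigD1 j) //= b0// mul0r.
  apply/rV_norm_le => [|j]; first exact: ltW.
  rewrite !mxE; have xj := x1 j; have qj := qz j.
  have : `|(x 0 j - q 0 j) * a| <= 2.
    have -> : (x 0 j - q 0 j) * a = (x 0 j * a + (K%:R - (z j)%:R)) -
      (q 0 j * a + (K%:R - (z j)%:R)) by ring.
    by apply: le_trans (ler_normB _ _) _; lra.
  rewrite normrM (gtr0_norm a0) /a mulrA ler_pdivrMr// [2 * _]mulrC.
  by rewrite ler_pM2r.
- move=> m.
  have beb (z : Z) : bounded_partials setT m ((2 ^+ m * (B m * 2 ^+ m / rho ^+ m)) ^+ n) (be z).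
    have := @bounded_partials_prod n setT m (B m * 2 ^+ m / rho ^+ m) _ (index_enum 'I_n)
      (fun j (x : 'rV[R]_n) => b 0%N (x 0 j * a + (K%:R - (z j)%:R))) openT (bes z).
    rewrite -[size _]/(size (index_enum 'I_n)).
    have -> : size (index_enum 'I_n) = n by rewrite size_index_enum card_ord.
    apply; first by rewrite divr_ge0 ?mulr_ge0 ?exprn_ge0//; [have := B1 m; lra|exact: ltW].
    move=> j s sm x _; rewrite iter_partial_scaled// !normrM normrX (gtr0_norm a0).
    apply: (@le_trans _ _ (1 * a ^+ m * B m)).
      apply: ler_pM => //; first by rewrite mulr_ge0// exprn_ge0// ltW.
        apply: ler_pM => //; first by rewrite exprn_ge0// ltW.
          by case: (all _ _); rewrite ?normr1 ?normr0.
        by apply: ler_weXn2l.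
      exact: BP.
    by rewrite mul1r /a expr_div_n [leLHS]mulrC mulrA.
  have sr : (size r)%:R <= ((4 * M' + 3) / rho) ^+ n.
    apply: (@le_trans _ _ ((K.*2.+1 ^ n)%N%:R)).
      rewrite ler_nat /r size_filter; apply: leq_trans (count_size _ _) _.
      by rewrite size_index_enum card_ffun !card_ord.
    rewrite natrX; apply: lerXn2r; rewrite ?nnegrE// ?divr_ge0//; [lra|exact: ltW|].
    rewrite ler_pdivlMr// -addn1 -addnn !natrD.
    have : K%:R * rho <= (M' * a + 1) * rho by rewrite ler_wpM2r// ltW.
    have -> : (M' * a + 1) * rho = 2 * M' + rho by rewrite /a; field; rewrite gt_eqF.
    lra.
  have := bounded_partials_sum r bez beb.
  apply: bounded_partialsW => //.
  set X := (_ * (B m * _ / _)) ^+ n.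
  have X0 : 0 <= X.
    by rewrite exprn_ge0// mulr_ge0 ?exprn_ge0// divr_ge0 ?mulr_ge0 ?exprn_ge0//;
      [have := B1 m; lra|exact: ltW].
  apply: (@le_trans _ _ (((4 * M' + 3) / rho) ^+ n * X)); first by rewrite ler_wpM2r.
  rewrite le_eqVlt; apply/orP; left; apply/eqP.
  rewrite /X exprD exprM mulrA !expr_div_n exprMn invfM; ring.
Qed.

End Cutoff.

(** * Translations and finite differences *)

Section Shift.
Context {R : realType}.
Implicit Types (p q : {poly R}) (u : R -> R).

(** R[X] acts on functions of one variable, the indeterminate acting as the
    translation by d; finite differences are the powers of 1 - 'X, and identities
    between them become polynomial identities. *)
Definition act (d : R) p u (s : R) : R := \sum_(k < size p) p`_k * u (s + k%:R * d).

Lemma act_widen d p u s N : (size p <= N)%N ->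
  act d p u s = \sum_(k < N) p`_k * u (s + k%:R * d).
Proof.
move=> pN; rewrite /act (big_ord_widen _ (fun k : nat => p`_k * u (s + k%:R * d)) pN).
rewrite big_mkcond; apply: eq_bigr => k _; case: ltnP => // kp.
by rewrite nth_default// mul0r.
Qed.

Lemma actD d p q u s : act d (p + q) u s = act d p u s + act d q u s.
Proof.
have [N [pN qN pqN]] : exists N, [/\ (size p <= N)%N, (size q <= N)%N & (size (p + q)%R <= N)%N].
  by exists (maxn (size p) (size q)); rewrite leq_maxl leq_maxr size_polyD.
rewrite (act_widen _ _ _ pN) (act_widen _ _ _ qN) (act_widen _ _ _ pqN) -big_split /=.
by apply: eq_bigr => k _; rewrite coefD mulrDl.
Qed.

Lemma actZ d c p u s : act d (c *: p) u s = c * act d p u s.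
Proof.
rewrite (act_widen _ _ _ (size_scale_leq c p)) /act mulr_sumr.
by apply: eq_bigr => k _; rewrite coefZ mulrA.
Qed.

Lemma actN d p u s : act d (- p) u s = - act d p u s.
Proof. by rewrite -scaleN1r actZ mulN1r. Qed.

Lemma actB d p q u s : act d (p - q) u s = act d p u s - act d q u s.
Proof. by rewrite actD actN. Qed.

Lemma actC d c u s : act d c%:P u s = c * u s.
Proof.
by rewrite (act_widen _ _ _ (size_polyC_leq1 c)) big_ord1 coefC eqxx mul0r addr0.
Qed.

Lemma actMX d p u s : act d (p * 'X) u s = act d p u (s + d).
Proof.
have sz : (size (p * 'X)%R <= (size p).+1)%N.
  by apply: leq_trans (size_polyMleq _ _) _; rewrite size_polyX addn2.
rewrite (act_widen _ _ _ sz) big_ord_recl coefMX eqxx mul0r add0r /act.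
apply: eq_bigr => k _; rewrite lift0 coefMX /=; congr (_ * u _).
by rewrite -natr1; ring.
Qed.

Lemma actM d p q u s : act d (p * q) u s = act d p (act d q u) s.
Proof.
elim/poly_ind: p s => [|p c IH] s; first by rewrite mul0r -polyC0 !actC !mul0r.
rewrite mulrDl !actD actC mul_polyC actZ; congr (_ + _).
by rewrite mulrAC !actMX IH.
Qed.

(** Halving the mesh amounts to substituting 'X^2 for 'X, which allows two
    successive scales to be compared. *)
Lemma act_comp_sqr d p u s : act d (p \Po 'X^2) u s = act (2 * d) p u s.
Proof.
elim/poly_ind: p s => [|p c IH] s; first by rewrite comp_poly0 -polyC0 !actC.
rewrite comp_polyD comp_polyM comp_polyX comp_polyC !actD !actC; congr (_ + _).
by rewrite expr2 mulrA !actMX IH; congr (act _ _ _ _); ring.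
Qed.

Lemma act_bound d p u s B : (forall k, (k < size p)%N -> `|u (s + k%:R * d)| <= B) ->
  `|act d p u s| <= (\sum_(k < size p) `|p`_k|) * B.
Proof.
move=> uB; rewrite /act mulr_suml; apply: le_trans (ler_norm_sum _ _ _) _.
by apply: ler_sum => k _; rewrite normrM ler_wpM2l// uB.
Qed.

Lemma is_derive_act (d : R) p u (du : R -> R) (t : R) :
  (forall k, (k < size p)%N -> is_derive (t + k%:R * d) (1 : R) u (du (t + k%:R * d))) ->
  is_derive t (1 : R) (act d p u) (act d p du t).
Proof.
move=> ud; rewrite /act.
have := @is_derive_sum _ _ _ (size p) (fun k s => p`_k * u (s + k%:R * d)) t 1
  (fun k => p`_k * du (t + k%:R * d)).
rewrite (_ : \sum_(i < _) _ = (fun s => \sum_(k < size p) p`_k * u (s + k%:R * d))); last first.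
  by apply/funext => s; rewrite fct_sumE.
apply=> k; have d1 : is_derive t (1 : R) (fun s : R => s + k%:R * d) 1.
  by have := is_deriveD (is_derive_id t (1 : R)) (is_derive_cst (k%:R * d) t (1 : R)); rewrite addr0.
have := is_derive_comp1 d1 (ud k (ltn_ord k)); rewrite mulr1 => ukd.
have [ex1 ex2] := is_deriveZ p`_k ukd.
by split.
Qed.

(** One mean value inequality per factor 1 - 'X; [w j] is the j-th derivative of
    [w 0]. *)
Lemma act_diff_bound (d : R) k (w : nat -> R -> R) (s E : R) : 0 <= d ->
  (forall j (t : R), (j < k)%N -> s <= t <= s + k%:R * d -> is_derive t (1 : R) (w j) (w j.+1 t)) ->
  (forall t, s <= t <= s + k%:R * d -> `|w k t| <= E) ->
  `|act d ((1 - 'X) ^+ k) (w 0%N) s| <= d ^+ k * E.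
Proof.
move=> d0; elim: k w s => [|k IH] w s wd wE.
  rewrite expr0 -polyC1 actC !mul1r; apply: wE; lra.
have kd : 0 <= k%:R * d by rewrite mulr_ge0.
have k1 : k.+1%:R * d = k%:R * d + d by rewrite -natr1; ring.
rewrite k1 in wd wE.
rewrite exprSr mulrBr mulr1 actB actMX distrC.
have -> : d ^+ k.+1 * E = d ^+ k * E * `|s + d - s|.
  by rewrite (_ : s + d - s = d) ?(ger0_norm d0) ?exprS; ring.
apply: (@mvt_bound _ _ (act d ((1 - 'X) ^+ k) (w 1%N))) => t;
  rewrite (min_idPl _) ?(max_idPr _) ?lerDl// => /andP[t1 t2].
  apply: is_derive_act => j jk; apply: wd => //.
  have : (j <= k)%N.
    have := leq_trans jk (size_poly_exp_leq _ _).
    rewrite -[1 - 'X]opprB size_polyN -polyC1 size_XsubC mul1n.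
    by rewrite ltnS.
  rewrite -(ler_nat R) => jk'.
  have : j%:R * d <= k%:R * d by rewrite ler_wpM2r.
  have : 0 <= j%:R * d by rewrite mulr_ge0.
  by move: t2; rewrite -subr_ge0 => *; apply/andP; split; lra.
apply: (IH (fun j => w j.+1)) => [j t' jk|t'] /andP[t'1 t'2].
  by apply: wd => //; apply/andP; split; lra.
by apply: wE; apply/andP; split; lra.
Qed.

End Shift.

(** * Newton extrapolation at slowly growing order *)

Section Extension.
Context {R : realType}.
Local Notation e_ i := (delta_mx 0 i : 'rV[R]_ _).

(** Raise the order by one as soon as the bound M at the next order is below
    C 2^i, and wait otherwise. *)
Lemma slow_sequence (M : nat -> R) : exists2 C : R, 0 < C & exists N : nat -> nat,
  [/\ N 0%N = 0%N, forall i, N i.+1 = N i \/ N i.+1 = (N i).+1,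
      forall i, M (N i) <= C * 2 ^+ i & forall k, exists i0, forall i, (i0 <= i)%N -> (k <= N i)%N].
Proof.
pose C := `|M 0%N| + 1; have C0 : 0 < C by rewrite ltr_wpDl.
exists C => //.
pose N := fix N i := if i is i'.+1 then
   (if M (N i').+1 <= C * 2 ^+ i'.+1 then (N i').+1 else N i') else 0%N.
have NS i : N i.+1 = if M (N i).+1 <= C * 2 ^+ i.+1 then (N i).+1 else N i by [].
have N2 i : N i.+1 = N i \/ N i.+1 = (N i).+1.
  by rewrite NS; case: ifP => _; [right|left].
exists N; split=> //.
  elim=> [|i IH]; first by rewrite expr0 mulr1 /= /C; have := ler_norm (M 0%N); lra.
  rewrite NS; case: ifPn => // _; apply: le_trans IH _.
  by rewrite ler_pM2l// ler_weXn2l// ler1n.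
have Nmono i j : (i <= j)%N -> (N i <= N j)%N.
  elim: j => [|j IH]; first by rewrite leqn0 => /eqP->.
  rewrite leq_eqVlt => /orP[/eqP->//|]; rewrite ltnS => /IH ij.
  by apply: leq_trans ij _; have [->|->] := N2 j.
elim=> [|k [i0 IH]]; first by exists 0%N.
suff [i1 i1P] : exists i1, (k < N i1)%N.
  by exists i1 => i ii; exact: leq_trans i1P (Nmono _ _ ii).
apply: contrapT => nk.
have Nk i : (i0 <= i)%N -> N i = k.
  move=> ii; apply/eqP; rewrite eqn_leq IH// andbT leqNgt; apply/negP => ki.
  by apply: nk; exists i.
have big i : (i0 <= i)%N -> C * 2 ^+ i.+1 < M k.+1.
  move=> ii; have := NS i; rewrite !Nk ?(leq_trans ii)//.
  by case: ifPn => [_ /n_Sn//|]; rewrite -ltNge.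
have [i ii] : exists i : nat, M k.+1 / C < i%:R.
  by exists (Num.truncn (M k.+1 / C)).+1; exact: truncnS_gt.
have := big (maxn i i0) (leq_maxr _ _); rewrite ltNge => /negP; apply.
rewrite mulrC -ler_pdivrMr//; apply/ltW; apply: lt_le_trans ii _.
rewrite -natrX ler_nat; apply: leq_trans (leq_maxl i i0) _.
by apply: ltnW; apply: leq_trans (ltn_expl _ (isT : 1 < 2)%N) _; rewrite leq_exp2l.
Qed.

(** Newton's series: 'X * newton N = 1 - (1 - 'X)^(N+1), so that newton N predicts
    the value at 0 from the values at positive multiples of the mesh. *)
Definition newton (N : nat) : {poly R} := \sum_(j < N.+1) (1 - 'X) ^+ j.

(** The cofactor of (1 - 'X)^(N+1) in the difference of the extrapolations of
    orders N + d and N at the meshes d and 2d, see [newton_diff]. *)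
Definition newton_quot (N d : nat) : {poly R} :=
  \sum_(j < N.+1) (1 + 'X) ^+ j + \sum_(j < d) (1 - 'X) ^+ j.

Lemma mulX_newton N : newton N * 'X = 1 - (1 - 'X) ^+ N.+1.
Proof.
have := subrX1 (1 - 'X : {poly R}) N.+1; rewrite -/(newton N) => E.
by rewrite -[RHS]opprB E; ring.
Qed.

(** After multiplication by 'X this is the difference of (1 - 'X^2)^(N+1) and
    (1 - 'X)^(N+d+1), in which (1 - 'X)^(N+1) factors out. *)
Lemma newton_diff N d : newton (N + d) - (newton N \Po 'X^2) * 'X =
  (1 - 'X) ^+ N.+1 * newton_quot N d.
Proof.
apply: (@mulIf _ 'X); first by rewrite polyX_eq0.
have E1 : (newton N \Po 'X^2) * 'X * 'X = 1 - (1 - 'X^2) ^+ N.+1.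
  have := congr1 (comp_poly 'X^2) (mulX_newton N).
  by rewrite rmorphM rmorphB rmorph1 rmorphXn rmorphB rmorph1 /= !comp_polyX expr2 mulrA.
have E2 : (\sum_(j < N.+1) (1 + 'X : {poly R}) ^+ j) * 'X = (1 + 'X) ^+ N.+1 - 1.
  by rewrite subrX1; ring.
have E3 : (\sum_(j < d) (1 - 'X : {poly R}) ^+ j) * 'X = 1 - (1 - 'X) ^+ d.
  by rewrite -[RHS]opprB subrX1; ring.
rewrite mulrBl E1 mulX_newton -mulrA /newton_quot [_ * 'X]mulrDl E2 E3.
have -> : (1 - 'X^2 : {poly R}) = (1 - 'X) * (1 + 'X) by ring.
by rewrite exprMn -addSn exprD; ring.
Qed.

Section BoundedSmooth.
Variables (n : nat) (W : set 'rV[R]_n).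
Hypothesis oW : open W.

Definition bounded_smooth (f : 'rV[R]_n -> R) :=
  smooth_on W f /\ forall m, exists2 K, 0 <= K & bounded_partials W m K f.

(** There are finitely many words of given length; the recursion peels off the
    innermost derivative, under which P is stable. *)
Lemma words_uniform (P : ('rV[R]_n -> R) -> Prop) (bd : ('rV[R]_n -> R) -> R -> Prop) :
  (forall f, P f -> exists K, bd f K) -> (forall f i, P f -> P ('D_(e_ i) f)) ->
  (forall f K K', K <= K' -> bd f K -> bd f K') ->
  forall m f, P f -> exists2 K, 0 <= K & forall s, (size s <= m)%N -> bd (iter_partial f s) K.
Proof.
move=> Pb Pd bdW; elim=> [|m IH] f Pf.
  have [K bK] := Pb f Pf; exists `|K| => // s; rewrite leqn0 size_eq0 => /eqP->.
  exact: bdW (ler_norm K) bK.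
have [K bK] := Pb f Pf.
have /choice[L LP] : forall i, exists K, 0 <= K /\ forall s, (size s <= m)%N -> bd (iter_partial ('D_(e_ i) f) s) K.
  by move=> i; have [K' K'0 K'P] := IH _ (Pd f i Pf); exists K'.
exists (`|K| + \sum_i L i).
  by rewrite addr_ge0// sumr_ge0// => i _; have [] := LP i.
move=> s; case/lastP: s => [_|s i].
  apply: bdW bK; apply: le_trans (ler_norm K) _; rewrite lerDl sumr_ge0// => i _.
  by have [] := LP i.
rewrite size_rcons ltnS iter_partial_rcons => sm; have [L0 LPi] := LP i.
apply: bdW (LPi s sm); rewrite (bigD1 i)//= addrCA lerDl addr_ge0// sumr_ge0// => j _.
by have [] := LP j.
Qed.

Lemma bounded_smoothP f : smooth_on W f ->
  (forall s, exists K, forall x, W x -> `|iter_partial f s x| <= K) -> bounded_smooth f.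
Proof.
move=> fs fb; split=> // m.
apply: (@words_uniform (fun f => forall s, exists K, forall x, W x -> `|iter_partial f s x| <= K)
  (fun f K => forall x, W x -> `|f x| <= K)) fb.
- by move=> g gb; exact: (gb [::]).
- by move=> g i gb s; have := gb (rcons s i); rewrite iter_partial_rcons.
- by move=> g K K' KK gK x Wx; apply: le_trans KK; exact: gK.
Qed.

Lemma bounded_smooth_partial f i : bounded_smooth f -> bounded_smooth ('D_(e_ i) f).
Proof.
move=> [fs fb]; split; first exact: smooth_on_partial.
move=> m; have [K K0 KP] := fb m.+1; exists K => // s sm x Wx.
by rewrite -iter_partial_rcons; apply: KP => //; rewrite size_rcons.
Qed.

Lemma bounded_smooth_lincomb (a : 'I_n -> R) (F : 'I_n -> 'rV[R]_n -> R) :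
  (forall i, bounded_smooth (F i)) -> bounded_smooth (fun x => \sum_i a i * F i x).
Proof.
move=> Fb.
have aFs i : smooth_on W (fun x => a i * F i x).
  by apply: (smooth_on_mul oW); [exact: smooth_on_cst|have [] := Fb i].
apply: bounded_smoothP; first exact: smooth_on_sum.
move=> s; have /choice[K KP] : forall i, exists K, bounded_partials W (size s) K (F i).
  by move=> i; have [_ /(_ (size s))[K _ KP]] := Fb i; exists K.
exists (\sum_i `|a i| * K i) => x Wx.
rewrite (iter_partial_sum _ s oW aFs (mem_set Wx)).
apply: le_trans (ler_norm_sum _ _ _) _; apply: ler_sum => i _.
have Fs : smooth_on W (F i) by have [] := Fb i.
by rewrite (iter_partial_scale (a i) s oW Fs (mem_set Wx)) normrM ler_wpM2l// KP.
Qed.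

Variable e : 'rV[R]_n.

(** The derivative along e, as a combination of partial derivatives in order to
    inherit their regularity and their bounds. *)
Definition dir (f : 'rV[R]_n -> R) (x : 'rV[R]_n) := \sum_i e 0 i * 'D_(e_ i) f x.

Lemma smooth_on_dir f : smooth_on W f -> smooth_on W (dir f).
Proof.
move=> fs; apply: (@smooth_on_sum _ _ W oW _ _ (fun i x => e 0 i * 'D_(e_ i) f x)) => i.
apply: (smooth_on_mul oW); first exact: smooth_on_cst.
exact: smooth_on_partial.
Qed.

Lemma is_derive_dir f x (t : R) : smooth_on W f -> W (x + t *: e) ->
  is_derive t (1 : R) (fun t => f (x + t *: e)) (dir f (x + t *: e)).
Proof.
move=> /smooth_onP fC Wx.
have pd j : is_derive t (1 : R) (fun t : R => (x + t *: e) 0 j) (e 0 j).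
  under [X in is_derive _ _ X _]eq_fun do rewrite 2!mxE.
  by have := is_deriveD (is_derive_cst (x 0 j) t (1 : R)) (is_derive_mulr (e 0 j) t); rewrite add0r.
have := @is_derive_comp_rV _ _ _ W f (fun t : R => x + t *: e) e t 1 oW (fC 1%N) Wx pd.
by rewrite /dir; under eq_bigr do rewrite mulrC.
Qed.

Lemma bounded_smooth_dir f j : bounded_smooth f -> bounded_smooth (iter j dir f).
Proof.
move=> fb; elim: j => [//|j IH] /=; apply: bounded_smooth_lincomb => i.
exact: bounded_smooth_partial.
Qed.

Lemma dir_uniform f j m : bounded_smooth f -> exists2 K, 0 <= K &
  forall s, (size s <= m)%N -> forall x, W x -> `|iter j dir (iter_partial f s) x| <= K.
Proof.
apply: (@words_uniform bounded_smooth (fun f K => forall x, W x -> `|iter j dir f x| <= K)).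
- move=> g gb; have [_ /(_ 0%N)[K _ KP]] := bounded_smooth_dir j gb.
  by exists K => x; exact: (KP [::]).
- by move=> g i; exact: bounded_smooth_partial.
- by move=> g K K' KK gK x Wx; apply: le_trans KK; exact: gK.
Qed.

End BoundedSmooth.

End Extension.

(** * Extension across the boundary *)

Section ExtensionThm.
Context {R : realType}.
Local Notation e_ i := (delta_mx 0 i : 'rV[R]_ _).

(** Around a point outside G the product vanishes identically, whatever D is. *)
Lemma smooth_cut n (G : set 'rV[R]_n) (chi D : 'rV[R]_n -> R) : open G ->
  smooth_on setT chi -> smooth_on G D ->
  (forall x, ~ G x -> exists V, [/\ open V, V x & forall y, V y -> chi y = 0]) ->
  smooth_on setT (fun x => chi x * D x) /\
  forall m K, 0 <= K -> bounded_partials G m K (fun x => chi x * D x) ->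
    bounded_partials setT m K (fun x => chi x * D x).
Proof.
move=> oG chis Ds chi0.
have zero (V : set 'rV[R]_n) : (forall y, V y -> chi y = 0) -> {in V, cst 0 =1 (fun x => chi x * D x)}.
  by move=> V0 y /set_mem /V0 ->; rewrite mul0r.
split=> [|m K K0 cDK s sm x _].
  apply: smooth_on_local => x _.
  have [Gx|/chi0[V [oV Vx V0]]] := pselect (G x).
    exists G, (fun x => chi x * D x); split; [exact: oG|exact: Gx| |by []].
    by apply: (smooth_on_mul oG); [exact: (smooth_on_sub _ chis)|exact: Ds].
  exists V, (cst 0); split => //; first exact: smooth_on_cst.
  by move=> y yV; rewrite -(zero _ V0 y yV).
have [Gx|/chi0[V [oV Vx V0]]] := pselect (G x); first exact: cDK.
rewrite -(iter_partial_ext s oV (zero _ V0) (mem_set Vx)) iter_partial_cst.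
by case: s {sm}; rewrite normr0.
Qed.

Lemma iter_partial_act n (W G : set 'rV[R]_n) (e : 'rV[R]_n) (f : 'rV[R]_n -> R)
    (d t0 : R) (p : {poly R}) : open W -> open G -> smooth_on W f ->
  (forall k x, (k < size p)%N -> G x -> W (x + (t0 + k%:R * d) *: e)) ->
  smooth_on G (fun x => act d p (fun t => f (x + t *: e)) t0) /\
  forall s x, G x -> iter_partial (fun x => act d p (fun t => f (x + t *: e)) t0) s x =
    act d p (fun t => iter_partial f s (x + t *: e)) t0.
Proof.
move=> oW oG fs GW.
have Fs (k : 'I_(size p)) : smooth_on G (fun x => f (x + (t0 + k%:R * d) *: e)).
  apply: (@smooth_on_sub _ _ [set x | W (x + (t0 + k%:R * d) *: e)]).
    by move=> x Gx; exact: GW.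
  exact: (@smooth_on_translate _ _ _ f).
have pFs (k : 'I_(size p)) : smooth_on G (fun x => p`_k * f (x + (t0 + k%:R * d) *: e)).
  by apply: (smooth_on_mul oG); [exact: smooth_on_cst|exact: Fs].
split=> [|s x Gx]; first exact: smooth_on_sum.
rewrite (iter_partial_sum _ s oG pFs (mem_set Gx)); apply: eq_bigr => k _.
by rewrite (iter_partial_scale p`_k s oG (Fs k) (mem_set Gx)) iter_partial_translate.
Qed.

(** The high power of 1 - 'X yields a factor d^k; the remaining polynomial
    involves nonnegative translations only, so that every point used stays on the
    half-line where f is controlled. *)
Lemma newton_step_bound n (W : set 'rV[R]_n) (e x : 'rV[R]_n) (f : 'rV[R]_n -> R)
    (d t1 K : R) (k : nat) (q : {poly R}) : open W -> 0 < d -> bounded_smooth W f ->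
  (forall t, d <= t <= t1 -> W (x + t *: e)) ->
  ((size q + k)%:R * d <= t1) ->
  (forall y, W y -> `|iter k (dir e) f y| <= K) ->
  `|act d ((1 - 'X) ^+ k * q) (fun t => f (x + t *: e)) d| <=
     (\sum_(j < size q) `|q`_j|) * (d ^+ k * K).
Proof.
move=> oW d0 fb xW szq fK; rewrite mulrC actM; apply: act_bound => j jq.
have jk : (j.+1 + k)%:R * d <= t1.
  by apply: le_trans szq; rewrite ler_pM2r// ler_nat leq_add2r.
rewrite natrD mulrDl -natr1 mulrDl mul1r in jk.
have j0 : 0 <= j%:R * d by rewrite mulr_ge0// ltW.
apply: (@act_diff_bound _ d k (fun i t => iter i (dir e) f (x + t *: e))); first exact: ltW.
  move=> i t ik /andP[ta tb]; apply: (@is_derive_dir _ _ W) => //.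
    by have [] := bounded_smooth_dir oW e i fb.
  by apply: xW; apply/andP; split; lra.
by move=> t /andP[ta tb]; apply/fK/xW/andP; split; lra.
Qed.

Lemma cvg_sum_seq (T : Type) (F : set_system T) {FF : Filter F} (I : Type) (r : seq I)
    (f : I -> T -> R) (l : I -> R) : (forall i, f i @ F --> l i) ->
  (fun t => \sum_(i <- r) f i t) @ F --> \sum_(i <- r) l i.
Proof.
move=> fl; elim: r => [|k r IH].
  rewrite big_nil (_ : (fun _ => _) = cst 0); first exact: cvg_cst.
  by apply/funext => t; rewrite big_nil.
rewrite big_cons (_ : (fun _ => _) = (fun t => f k t + \sum_(i <- r) f i t)); last first.
  by apply/funext => t; rewrite big_cons.
exact: cvgD.
Qed.

Lemma act_cvg (d : R) (p : {poly R}) (u : R -> R) :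
  (forall k, (k < size p)%N -> u (t + k%:R * d) @[t --> 0^'+] --> u (k%:R * d)) ->
  act d p u t @[t --> 0^'+] --> act d p u 0.
Proof.
move=> uc; have E (k : 'I_(size p)) : u (0 + k%:R * d) = u (k%:R * d) by rewrite add0r.
rewrite /act; under eq_bigr do rewrite E.
by apply: cvg_sum_seq => k; apply: cvgM; [exact: cvg_cst|exact: uc].
Qed.

(** Here W stands for the interior of the convex set, near the point under
    consideration, and Q for a smaller piece of the set itself; the hypothesis with
    r and s0 says that each point of Q is the apex of a cone of axis e contained in W. *)
Theorem smooth_extension n (Q W : set 'rV[R]_n) (h : 'rV[R]_n -> R) (e : 'rV[R]_n)
    (r s0 M : R) : open W -> 0 < r <= 1 -> 0 < s0 -> (forall q, Q q -> `|q| <= M) ->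
  (forall q y s, Q q -> 0 < s <= s0 -> `|y - q| <= r * s -> W (y + s *: e)) ->
  smooth_on W h ->
  (forall s, exists K, forall x, W x -> `|iter_partial h s x| <= K) ->
  (forall q, Q q -> h (q + t *: e) @[t --> 0^'+] --> h q) ->
  exists2 g, smooth_on setT g & forall q, Q q -> g q = h q.
Proof.
move=> oW /andP[r0 r1] s00 QM cone hs hb hlim.
have hbs : bounded_smooth W h by exact: bounded_smoothP.
have /choice[K KP] : forall k, exists K, 0 <= K /\ forall s, (size s <= k)%N ->
    forall x, W x -> `|iter k.+1 (dir e) (iter_partial h s) x| <= K.
  by move=> k; have [K K0 KP] := dir_uniform oW e k.+1 k hbs; exists K.
pose P k d : {poly R} := (1 - 'X) ^+ k.+1 * newton_quot k d.
(* [l k] is an upper bound for the numbers of translations used at order k,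
   and [Mh k] for all the constants that depend on the order *)
pose l k := (2 * (size (newton k : {poly R}) + size (P k 0%N) + size (P k 1%N) +
   size (newton_quot k 0%N : {poly R}) + size (newton_quot k 1%N : {poly R}) + k + 4))%N.
pose l1 (p : {poly R}) := \sum_(j < size p) `|p`_j|.
have l10 p : 0 <= l1 p by rewrite sumr_ge0.
pose c1 k := 1 + l1 (newton_quot k 0%N) + l1 (newton_quot k 1%N).
pose Mh k := c1 k * K k + (l k)%:R.
have K0 k : 0 <= K k by have [] := KP k.
have c10 k : 0 <= c1 k by rewrite !addr_ge0.
have [C C0 [N [N0 Nstep NC Ninf]]] := slow_sequence Mh.
have lC i : (l (N i))%:R <= C * 2 ^+ i by apply: le_trans (NC i); rewrite lerDr mulr_ge0.
have KC i : c1 (N i) * K (N i) <= C * 2 ^+ i by apply: le_trans (NC i); rewrite lerDl.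
(* this choice keeps all the points used within the height s0 of the cones *)
pose c := Num.min 1 (s0 / C).
have c0 : 0 < c by rewrite lt_min ltr01 divr_gt0.
have c1' : c <= 1 by rewrite ge_min lexx.
have cC : c * C <= s0 by rewrite -ler_pdivlMr// ge_min lexx orbT.
pose ep i : R := c / 2 ^+ i.
have p2 i : 0 < 2 ^+ i :> R by rewrite exprn_gt0.
have ep0 i : 0 < ep i by rewrite divr_gt0.
have epS i : ep i = 2 * ep i.+1.
  by rewrite /ep exprS; field; rewrite gt_eqF.
have ep1 i : ep i <= (2 ^+ i)^-1 by rewrite /ep ler_piMl// invr_ge0 ltW.
have lep i : (l (N i))%:R * ep i <= s0.
  apply: le_trans cC; by rewrite /ep mulrCA ler_pM2l// ler_pdivrMr//.
have lepk i k j : (k <= l (N i))%N -> (i <= j)%N -> k%:R * ep j <= s0.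
  move=> kl ij; apply: le_trans (lep i); apply: ler_pM => //; first exact: ltW.
    by rewrite ler_nat.
  by rewrite /ep ler_pM2l// lef_pV2 ?posrE// ler_weXn2l// ler1n.
pose G i : set 'rV[R]_n := [set x | exists2 q, Q q & `|x - q| < r * ep i].
have oG i : open (G i).
  rewrite (_ : G i = \bigcup_(q in Q) ball q (r * ep i)).
    by apply: bigcup_open => q _; exact: ball_open.
  apply/seteqP; split=> x [q Qq xq]; exists q => //.
    by rewrite -ball_normE /= distrC.
  by move: xq; rewrite -ball_normE /= distrC.
have GW i x t : G i x -> ep i <= t <= s0 -> W (x + t *: e).
  move=> [q Qq xq] /andP[t1 t2]; apply: (cone q) => //.
    by rewrite t2 andbT; exact: lt_le_trans t1.
  by apply: le_trans (ltW xq) _; rewrite ler_pM2l.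
pose u (x : 'rV[R]_n) t := h (x + t *: e).
pose T i x := act (ep i) (newton (N i)) (u x) (ep i).
pose D i x := act (ep i.+1) (P (N i) (N i.+1 - N i)%N) (u x) (ep i.+1).
have DT i x : D i x = T i.+1 x - T i x.
  rewrite /D /P -newton_diff subnKC; last by case: (Nstep i) => ->.
  by rewrite actB; congr (_ - _); rewrite actMX act_comp_sqr -epS; congr (act _ _ _ _);
    rewrite (epS i); ring.
have sN i : (N i.+1 - N i = 0)%N \/ (N i.+1 - N i = 1)%N.
  by case: (Nstep i) => ->; [left; rewrite subnn|right; rewrite subSn ?subnn].
have szP i : (size (P (N i) (N i.+1 - N i)%N) + 4 <= l (N i))%N.
  by case: (sN i) => ->; rewrite /l; lia.
have szQ i : (size (newton_quot (N i) (N i.+1 - N i)%N : {poly R}) + (N i).+1 <= l (N i))%N.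
  by case: (sN i) => ->; rewrite /l; lia.
have l1Q i : l1 (newton_quot (N i) (N i.+1 - N i)%N) <= c1 (N i).
  case: (sN i) => ->; rewrite /c1.
    by have := l10 (newton_quot (N i) 1%N); lra.
  by have := l10 (newton_quot (N i) 0%N); lra.
have rangeP i k : (k < size (P (N i) (N i.+1 - N i)%N))%N ->
    ep i.+1 <= ep i.+1 + k%:R * ep i.+1 <= s0.
  move=> kP; rewrite lerDl mulr_ge0 ?(ltW (ep0 _))//=.
  rewrite -[X in X + _]mul1r -mulrDl nat1r; apply: (lepk i) => //.
  by apply: leq_trans (szP i); lia.
have Dact i := @iter_partial_act n W (G i.+1) e h (ep i.+1) (ep i.+1)
   (P (N i) (N i.+1 - N i)%N) oW (oG i.+1) hs
   (fun k x kP Gx => GW i.+1 x _ Gx (rangeP i k kP)).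
have Tact := @iter_partial_act n W (G 0%N) e h (ep 0%N) (ep 0%N) (newton (N 0%N)) oW (oG 0%N) hs.
have T0s : smooth_on (G 0%N) (T 0%N).
  apply: (Tact _).1 => k x kN Gx; apply: (GW 0%N) => //.
  rewrite lerDl mulr_ge0 ?(ltW (ep0 _))//=.
  rewrite -[X in X + _]mul1r -mulrDl nat1r; apply: (lepk 0%N) => //.
  by rewrite /l; lia.
have Dbound i s x : G i.+1 x -> (size s <= N i)%N ->
    `|iter_partial (D i) s x| <= ep i.+1 ^+ (N i).+1 * (C * 2 ^+ i).
  move=> Gx sN'; have [_ ->//] := Dact i.
  have fb : bounded_smooth W (iter_partial h s).
    split=> [|m]; last first.
      have [_ /(_ (m + size s)%N)[K' K'0 K'P]] := hbs; exists K' => // s' sm y Wy.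
      rewrite /iter_partial -foldr_cat; apply: K'P => //.
      by rewrite size_cat leq_add2r.
    move=> s' y Wy; rewrite /iter_partial -foldr_cat; exact: hs.
  have := @newton_step_bound n W e x (iter_partial h s) (ep i.+1) s0 (K (N i)) (N i).+1
    (newton_quot (N i) (N i.+1 - N i)%N) oW (ep0 _) fb
    (fun t => GW i.+1 x t Gx) (lepk i _ _ (szQ i) (leqnSn i)) ((KP (N i)).2 s sN').
  move=> /le_trans; apply.
  rewrite mulrCA ler_pM2l ?exprn_gt0//; apply: le_trans (KC i).
  apply: ler_wpM2r => //; exact: l1Q.
pose E i := if i is i'.+1 then D i' else T 0%N.
have Es i : smooth_on (G i) (E i) by case: i => [//|i] /=; have [] := Dact i.
have [L [Pw [L0 cut]]] := cutoff_exists QM.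
have rho01 i : 0 < r * ep i / 2 <= 1.
  have e1 : ep i <= 1.
    by apply: le_trans (ep1 i) _; rewrite invf_le1// exprn_ege1// ler1n.
  have re0 : 0 < r * ep i by rewrite mulr_gt0.
  have re1 : r * ep i <= 1 * 1 by apply: ler_pM => //; exact: ltW.
  by apply/andP; split; lra.
have /choice[chi chiP] := fun i => cut _ (rho01 i).
have chi0 i x : ~ G i x -> exists V, [/\ open V, V x & forall y, V y -> chi i y = 0].
  move=> nG; exists (ball x (r * ep i / 2)); have /andP[rr _] := rho01 i.
  split; [exact: ball_open|exact: ballxx|move=> y].
  rewrite -ball_normE /= => xy; apply: contrapT => /eqP cy.
  have [_ _ /(_ y cy)[q Qq yq] _] := chiP i; apply: nG; exists q => //.
  have -> : x - q = (x - y) + (y - q) by rewrite addrA subrK.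
  by apply: le_lt_trans (ler_normD _ _) _; lra.
have chis i : smooth_on setT (chi i) by have [] := chiP i.
have fcut i := smooth_cut (oG i) (chis i) (Es i) (chi0 i).
pose f i x := chi i x * E i x.
have fb s : exists c i0, forall i x, (i0 <= i)%N -> `|iter_partial (f i) s x| <= c / 2 ^+ i.
  set m := size s; have [i0 i0P] := Ninf (m + Pw m + 2)%N.
  exists (2 ^+ m * (L m * (2 / r) ^+ Pw m * C)), i0.+1 => -[//|i] x; rewrite ltnS => ii.
  have NP := i0P i ii.
  pose d := ep i.+1; pose rho := r * d / 2.
  have d0 : 0 < d by exact: ep0.
  have d1 : d <= (2 ^+ i.+1)^-1 by exact: ep1.
  have rr : 0 < rho by have /andP[] := rho01 i.+1.
  have chib : bounded_partials (G i.+1) m (L m / rho ^+ Pw m) (chi i.+1).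
    by have [_ _ _ /(_ m) cb] := chiP i.+1 => t tm y _; exact: cb.
  have Db : bounded_partials (G i.+1) m (d ^+ (N i).+1 * (C * 2 ^+ i)) (E i.+1).
    move=> t tm y Gy; apply: Dbound => //; apply: leq_trans tm _.
    by apply: leq_trans NP; rewrite -addnA leq_addr.
  have A0 : 0 <= L m / rho ^+ Pw m by rewrite divr_ge0// exprn_ge0// ltW.
  have B0 : 0 <= d ^+ (N i).+1 * (C * 2 ^+ i).
    by rewrite !mulr_ge0// ?exprn_ge0 ?ltW.
  have chisG : smooth_on (G i.+1) (chi i.+1) by exact: (smooth_on_sub _ (chis i.+1)).
  have := bounded_partials_mul (oG i.+1) chisG (Es i.+1) A0 B0 chib Db.
  have X0 := mulr_ge0 (exprn_ge0 m (ler0n R 2)) (mulr_ge0 A0 B0).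
  move=> /((fcut i.+1).2 _ _ X0) fb'.
  apply: le_trans (fb' s (leqnn _) x I) _.
  rewrite -[leRHS]mulrA ler_pM2l ?exprn_gt0//.
  have -> : L m / rho ^+ Pw m = L m * (2 / r) ^+ Pw m * (d ^+ Pw m)^-1.
    rewrite -mulrA -exprVn -exprVn -exprMn; congr (_ * _ ^+ _).
    by rewrite /rho; field; rewrite !gt_eqF.
  rewrite -!mulrA; apply: ler_wpM2l => //; apply: ler_wpM2l.
    by rewrite exprn_ge0// divr_ge0// ltW.
  (* the order exceeds the exponent of 1 / d in the bound for the cutoff by enough
     to leave a factor d^2 *)
  have dd : d ^+ (N i).+1 <= d ^+ Pw m * d ^+ 2.
    have PN : (Pw m + 2 <= (N i).+1)%N.
      by apply: leq_trans (leqnSn _); apply: leq_trans NP; rewrite -addnA leq_addl.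
    rewrite -exprD; apply: ler_wiXn2l => //; first exact: ltW.
    by apply: le_trans d1 _; rewrite invf_le1// exprn_ege1// ler1n.
  rewrite [leLHS](_ : _ = C * ((d ^+ Pw m)^-1 * d ^+ (N i).+1 * 2 ^+ i)); last by ring.
  apply: ler_wpM2l; first exact: ltW.
  apply: (@le_trans _ _ (d ^+ 2 * 2 ^+ i)).
    rewrite ler_pM2r// mulrC ler_pdivrMr ?exprn_gt0// mulrC//.
  have -> : d ^+ 2 * 2 ^+ i = d * (d * 2 ^+ i.+1) / 2 by rewrite (exprS 2 i); field.
  have d2 : d * 2 ^+ i.+1 <= 1 by rewrite -ler_pdivlMr// mul1r.
  have : d * (d * 2 ^+ i.+1) <= d * 1 by rewrite ler_pM2l.
  lra.
have [g gs gP] := smooth_series (fun i => (fcut i).1) fb.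
exists g => // q Qq.
have fq i : f i q = E i q by have [_ c1q _ _] := chiP i; rewrite /f c1q// mul1r.
have sumT k : \sum_(i < k.+1) f i q = T k q.
  elim: k => [|k IH]; first by rewrite big_ord1 fq.
  by rewrite big_ord_recr IH fq /= DT addrC subrK.
have Tlim k : (1 <= N k)%N -> `|T k q - h q| <= C / 2 ^+ k.
  move=> Nk; set A : {poly R} := (1 - 'X) ^+ (N k).+1.
  have uq0 : u q 0 = h q by rewrite /u scale0r addr0.
  have -> : T k q - h q = - act (ep k) A (u q) 0.
    rewrite /T -[X in act _ _ _ X]add0r -actMX mulX_newton actB -polyC1 actC mul1r uq0.
    by rewrite addrAC subrr add0r polyC1.
  have szA : (size A <= (N k).+2)%N.
    apply: leq_trans (size_poly_exp_leq _ _) _.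
    by rewrite -[1 - 'X]opprB size_polyN -polyC1 size_XsubC mul1n.
  have Wq t : 0 < t <= s0 -> W (q + t *: e).
    by move=> /andP[t0 t1]; apply: (cone q); rewrite ?t0// subrr normr0 mulr_ge0// ltW.
  have s0k j : (j <= (N k).+2)%N -> j%:R * ep k <= s0.
    by move=> jk; apply: (lepk k) => //; apply: leq_trans jk _; rewrite /l; lia.
  (* the cone at q gives bounds for t > 0 only; then let t tend to 0 *)
  have actlim : act (ep k) A (u q) t @[t --> 0^'+] --> act (ep k) A (u q) 0.
    apply: act_cvg => j jA; have [->|j0] := eqVneq j 0%N.
      rewrite mul0r uq0 (_ : (fun t => _) = u q); first exact: (hlim q Qq).
      by apply/funext => t; rewrite addr0.
    have jk : (j <= (N k).+1)%N by rewrite -ltnS; exact: leq_trans jA szA.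
    have jW : W (q + (0 + j%:R * ep k) *: e).
      by apply: Wq; rewrite add0r mulr_gt0 ?ltr0n ?lt0n// s0k// ltnW.
    apply: cvg_at_right_filter.
    have d1 : is_derive (0 : R) (1 : R) (fun t : R => t + j%:R * ep k) 1.
      by have := is_deriveD (is_derive_id (0 : R) (1 : R)) (is_derive_cst (j%:R * ep k) (0 : R) (1 : R)); rewrite addr0.
    have [d2 _] := is_derive_comp1 d1 (is_derive_dir oW hs jW).
    have -> : u q (j%:R * ep k) =
        ((fun t => h (q + t *: e)) \o (fun t : R => t + j%:R * ep k)) 0.
      by rewrite /u /= add0r.
    have cc := differentiable_continuous ((derivable1_diffP _ _).1 d2).
    exact: cc.
  have actb : \forall t \near (0 : R)^'+, `|act (ep k) A (u q) t| <= C / 2 ^+ k.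
    near=> t; have t0 : 0 < t by [].
    have tep : t <= ep k by near: t; exact: nbhs_right_le.
    have Ns := s0k (N k).+2 (leqnn _); rewrite -natr1 mulrDl mul1r in Ns.
    have ab : `|act (ep k) A (u q) t| <= ep k ^+ (N k).+1 * K (N k).
      apply: (@act_diff_bound _ _ _ (fun i t => iter i (dir e) h (q + t *: e))).
      - exact: ltW.
      - move=> j t' jk /andP[ta tb]; apply: (@is_derive_dir _ _ W) => //.
          by have [] := bounded_smooth_dir oW e j hbs.
        by apply: Wq; apply/andP; split; lra.
      - move=> t' /andP[ta tb]; apply: ((KP (N k)).2 [::]) => //.
        by apply: Wq; apply/andP; split; lra.
    apply: le_trans ab _.
    have Kk : K (N k) <= C * 2 ^+ k.
      by apply: le_trans (KC k); rewrite ler_peMl// /c1 -addrA lerDl addr_ge0.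
    apply: (@le_trans _ _ (ep k ^+ 2 * (C * 2 ^+ k))).
      apply: ler_pM => //; first by rewrite exprn_ge0// ltW.
      apply: ler_wiXn2l => //; first exact: ltW.
      by apply: le_trans (ep1 k) _; rewrite invf_le1// exprn_ege1// ler1n.
    have -> : ep k ^+ 2 * (C * 2 ^+ k) = C * (ep k * (ep k * 2 ^+ k)) by ring.
    rewrite ler_pM2l//; apply: le_trans (ep1 k); rewrite ler_piMr ?(ltW (ep0 _))//.
    by rewrite -ler_pdivlMr// mul1r.
  rewrite normrN -(cvg_lim (@Rhausdorff R) (cvg_norm actlim)).
  by apply: limr_le => //; apply/cvg_ex; eexists; exact: cvg_norm actlim.
have Tcvg : (fun k => T k q) @ \oo --> h q.
  have [i0 i0P] := Ninf 1%N.
  apply: (@squeeze_cvgr _ _ _ _ (fun k => h q - C / 2 ^+ k) (fun k => h q + C / 2 ^+ k)).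
  - near=> k; have : `|T k q - h q| <= C / 2 ^+ k.
      by apply/Tlim/i0P; near: k; exact: nbhs_infty_ge.
    by rewrite ler_norml => /andP[a b]; apply/andP; split; lra.
  - by rewrite -[X in _ --> X]subr0; apply: cvgB; [exact: cvg_cst|exact: cvg_half_pow].
  - by rewrite -[X in _ --> X]addr0; apply: cvgD; [exact: cvg_cst|exact: cvg_half_pow].
have gq : (fun k => \sum_(i < k.+1) f i q) @ \oo --> g q.
  by have := gP q; rewrite -cvg_shiftS.
have sE : (fun k => \sum_(i < k.+1) f i q) = (fun k => T k q) by apply/funext.
by rewrite sE in gq; rewrite -(cvg_lim (@Rhausdorff R) gq) (cvg_lim (@Rhausdorff R) Tcvg).
Unshelve. all: by end_near. Qed.

End ExtensionThm.

(** * Functions smooth along plots *)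

Section PlotSmooth.
Context {R : realType}.
Local Notation e_ i := (delta_mx 0 i : 'rV[R]_ _).

(** The composites of h with all smooth maps into S: smoothness of h for the
    diffeology of S induced by R^n. *)
Definition plot_smooth n (S : set 'rV[R]_n) (h : 'rV[R]_n -> R) :=
  forall d (U : set 'rV[R]_d) (p : 'rV[R]_d -> 'rV[R]_n), open U ->
    (forall j, smooth_on U (fun u => p u 0 j)) -> (forall u, U u -> S (p u)) ->
    smooth_on U (h \o p).

Lemma plot_smooth_on n (S V : set 'rV[R]_n) h : open V -> V `<=` S ->
  plot_smooth S h -> smooth_on V h.
Proof.
move=> oV VS hS; apply: (hS n V id) => // j; exact: smooth_on_coord.
Qed.

Section SpecialCurve.
Variables (n : nat) (S : set 'rV[R]_n) (a : 'rV[R]_n) (x : nat -> 'rV[R]_n).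
Hypothesis starS : forall y t, S y -> 0 <= t <= 1 -> S (a + t *: (y - a)).
Hypothesis Sx : forall k, S (x k).
Variable b : nat -> R -> R.
Hypotheses (bd : derivative_family b) (b01 : forall t, 0 <= b 0%N t <= 1)
  (b00 : b 0%N 0 = 1) (bz : forall t, 1 <= `|t| -> b 0%N t = 0).
Variable B : nat -> R.
Hypothesis bB : forall m k t, (k <= m)%N -> `|b k t| <= B m.
Hypothesis xa : forall k, `|x k - a| * ((4 * 2 ^+ k) ^+ k * B k) <= 1 / 2 ^+ k.

Let chi k (t : 'rV[R]_1) := b 0%N (t 0 0 * (4 * 2 ^+ k) + - 4).

Let chi_disjoint k l t : chi k t != 0 -> chi l t != 0 -> k = l.
Proof.
have half i : chi i t != 0 -> `|t 0 0 * (4 * 2 ^+ i) - 4| < 1.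
  by apply: contraNT; rewrite -leNgt /chi => /bz ->.
move=> /half + /half; wlog kl : k l / (k < l)%N => [wl|].
  have [kl|kl|->//] := ltngtP k l; first exact: wl.
  by move=> hk hl; apply/esym; exact: (wl l k).
rewrite !ltr_norml => /andP[k1 k2] /andP[l1 l2].
have : 2 * 2 ^+ k <= 2 ^+ l :> R by rewrite -exprS ler_weXn2l// ler1n.
have t0 : 0 < t 0 0.
  have : 0 < t 0 0 * (4 * 2 ^+ k) by lra.
  by rewrite pmulr_lgt0// mulr_gt0// exprn_gt0.
by rewrite -(ler_pM2l t0) => ?; exfalso; lra.
Qed.

(** The curve visits x k at time 2^-k by leaving a along the segment from a to x k
    and returning, during disjoint time intervals.  It is smooth at 0 as soon as x k
    tends to a fast enough to beat the derivatives of the k-th bump. *)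
Lemma special_curve : exists2 p : 'rV[R]_1 -> 'rV[R]_n,
  (forall j, smooth_on setT (fun u => p u 0 j)) &
  [/\ forall u, S (p u), p 0 = a & forall k, p (((2 ^+ k)^-1)%:M) = x k].
Proof.
have chis k : smooth_on setT (chi k).
  apply: (@smooth_on_family _ _ _ b (fun t : 'rV[R]_1 => t 0 0 * (4 * 2 ^+ k) + - 4)) => //.
    exact: openT.
  by apply: smooth_on_affine; exact: openT.
pose f j k t := (x k - a) 0 j * chi k t.
have fs j k : smooth_on setT (f j k).
  by apply: (smooth_on_mul openT); [exact: smooth_on_cst|exact: chis].
have fb j s : exists c i0, forall k t, (i0 <= k)%N -> `|iter_partial (f j k) s t| <= c / 2 ^+ k.
  exists 1, (size s) => k t sk.
  have -> := iter_partial_scale ((x k - a) 0 j) s openT (chis k) (mem_set (Logic.I : setT t)).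
  rewrite iter_partial_scaled//; apply: le_trans (xa k).
  rewrite normrM; apply: ler_pM => //; first exact: coord_norm_le.
  rewrite normrM; apply: ler_pM => //; last exact: bB.
  rewrite normrM normrX (@ger0_norm _ (4 * _)) ?mulr_ge0 ?exprn_ge0//.
  apply: (@le_trans _ _ (1 * (4 * 2 ^+ k) ^+ size s)).
    apply: ler_wpM2r; first by rewrite exprn_ge0// mulr_ge0// exprn_ge0.
    by case: (all _ _); rewrite ?normr1 ?normr0.
  rewrite mul1r; apply: ler_weXn2l => //.
  have : 1 <= 2 ^+ k :> R by rewrite exprn_ege1// ler1n.
  lra.
have /choice[g gP] : forall j, exists g, smooth_on setT g /\
    forall t, (fun N : nat => \sum_(i < N) f j i t) @ \oo --> g t.
  by move=> j; have [g gs gP] := smooth_series (fs j) (fb j); exists g.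
have gE j t k : (forall i, i != k -> chi i t = 0) -> g j t = (x k - a) 0 j * chi k t.
  move=> ik; have [_ /(_ t) gt] := gP j.
  rewrite -(cvg_lim (@Rhausdorff R) gt); apply: (cvg_lim (@Rhausdorff R)).
  apply: cvg_near_cst; exists k.+1 => // N /= kN.
  rewrite (bigD1 (Ordinal kN)) //= big1 ?addr0// => i ni.
  by rewrite /f ik ?mulr0.
exists (fun t => a + \row_j g j t).
  move=> j; under eq_fun do rewrite 2!mxE.
  apply: smooth_on_add; [exact: openT|exact: smooth_on_cst|].
  by have [] := gP j.
have pE t k : (forall i, i != k -> chi i t = 0) -> a + \row_j g j t = a + chi k t *: (x k - a).
  move=> ik; congr (_ + _); apply/rowP => j.
  by rewrite [LHS]mxE (gE j t k ik) mulrC [RHS]mxE.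
split=> [t||k].
- have [[k ck]|nk] := pselect (exists k, chi k t != 0).
    rewrite (pE t k); last first.
      move=> i ik; apply/eqP; apply: contraNT ik => ci.
      by apply/eqP; exact: (chi_disjoint ci ck).
    by apply: starS => //; exact: b01.
  rewrite (pE t 0%N); last first.
    by move=> i _; apply/eqP; apply: contrapT => /negP ci; apply: nk; exists i.
  by apply: starS => //; exact: b01.
- have c0 i : chi i 0 = 0.
    by rewrite /chi mxE mul0r add0r bz// normrN ger0_norm// ler1n.
  by rewrite (pE 0 0%N)// c0 scale0r addr0.
- have ck : chi k ((2 ^+ k)^-1)%:M = 1.
    have k0 : 2 ^+ k != 0 :> R by rewrite gt_eqF// exprn_gt0.
    by rewrite /chi mxE eqxx mulr1n mulrCA mulVf// mulr1 subrr b00.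
  rewrite (pE _ k); first by rewrite ck scale1r addrC subrK.
  move=> i ik; apply/eqP; apply: contraNT ik => ci.
  by apply/eqP; apply: (chi_disjoint ci); rewrite ck oner_neq0.
Qed.

End SpecialCurve.

(** Otherwise a bad sequence tends to a as fast as one likes, and h is
    discontinuous along the smooth curve through it. *)
Lemma plot_smooth_continuous n (S : set 'rV[R]_n) (h : 'rV[R]_n -> R) (a : 'rV[R]_n) :
  (forall y t, S y -> 0 <= t <= 1 -> S (a + t *: (y - a))) -> plot_smooth S h ->
  forall eps, 0 < eps -> exists2 d, 0 < d & forall y, S y -> `|y - a| < d -> `|h y - h a| < eps.
Proof.
move=> starS hS eps eps0; apply: contrapT => nd.
have bad d : 0 < d -> exists y, [/\ S y, `|y - a| < d & eps <= `|h y - h a|].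
  move=> d0; apply: contrapT => ny; apply: nd; exists d => // y Sy yd.
  by rewrite ltNge; apply/negP => hy; apply: ny; exists y.
have [b bd [b01 b00 b0 _ bB]] := @bump_partition R.
have [B B1 BP] := family_bound bB.
pose c k := (4 * 2 ^+ k) ^+ k * B k : R.
have c0 k : 0 < c k.
  by rewrite mulr_gt0 ?exprn_gt0 ?mulr_gt0 ?exprn_gt0//; exact: lt_le_trans (B1 k).
have /choice[x xP] : forall k, exists y, [/\ S y, `|y - a| < (2 ^+ k)^-1 / c k & eps <= `|h y - h a|].
  by move=> k; apply: bad; rewrite divr_gt0// invr_gt0 exprn_gt0.
have Sx k : S (x k) by have [] := xP k.
have xa k : `|x k - a| * c k <= 1 / 2 ^+ k.
  by have [_ xk _] := xP k; rewrite -ler_pdivlMr// mul1r ltW.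
have [p ps [pS p0 pk]] := special_curve starS Sx bd b01 b00 b0 BP xa.
have hps : smooth_on setT (h \o p) by apply: hS => //; exact: openT.
have [hc _] := hps [::] 0 Logic.I.
have /cvgrPdist_lt/(_ _ eps0) := hc.
move=> /nbhs_normP[r /= r0 rP].
have : \forall k \near \oo, (1 / 2 ^+ k : R) < r.
  by apply: (cvgr_lt 0) => //; exact: cvg_half_pow.
move=> /filter_ex[k kr].
have := rP (((2 ^+ k)^-1)%:M); rewrite /ball_/= p0 pk.
have [_ _ hk] := xP k => lt; have : `|h a - h (x k)| < eps.
  apply: lt; rewrite sub0r normrN; apply/rV_norm_lt => // j.
  by rewrite ord1 mxE eqxx mulr1n ger0_norm ?invr_ge0 ?exprn_ge0// -[_^-1]mul1r.
by rewrite distrC ltNge hk.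
Qed.

End PlotSmooth.

(** * Derivatives at the boundary *)

Section SquareDerivative.
Context {R : realType}.
Local Notation e_ i := (delta_mx 0 i : 'rV[R]_ _).

(** The parameter t^2 makes the curve a plot even when x + s v belongs to the set
    for s >= 0 only; as the curve is even in t, the first derivative that carries
    information is the second one. *)
Definition square_derive n (v : 'rV[R]_n) (h : 'rV[R]_n -> R) (x : 'rV[R]_n) : R :=
  2^-1 * 'D_1 ('D_1 (fun t : R => h (x + t ^+ 2 *: v))) 0.

Lemma open_preimage_in n m (A : set 'rV[R]_n) (O : set 'rV[R]_m) (p : 'rV[R]_n -> 'rV[R]_m) :
  open A -> open O -> (forall x, A x -> {for x, continuous p}) -> open (A `&` p @^-1` O).
Proof.
move=> oA oO pc; rewrite openE => x [Ax Opx].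
apply: filterI; first exact: (open_nbhs_nbhs (conj oA Ax)).
by apply: pc => //; exact: (open_nbhs_nbhs (conj oO Opx)).
Qed.

(** Together, the parameters of a plot p and t form the parameters of the plot
    p(u) + t^2 v.  A second partial derivative in t, restricted to t = 0, is smooth in u. *)
Lemma plot_smooth_square_derive n (S O : set 'rV[R]_n) (v : 'rV[R]_n) h : open O ->
  S `<=` O ->
  (forall x t, S x -> 0 <= t <= 1 -> O (x + t *: v) -> S (x + t *: v)) ->
  plot_smooth S h -> plot_smooth S (square_derive v h).
Proof.
move=> oO SO Sv hS d U p oU ps pU.
pose l : 'I_(d + 1) := rshift d 0.
pose P (w : 'rV[R]_(d + 1)) := p (lsubmx w) + (w 0 l) ^+ 2 *: v.
pose A : set 'rV[R]_(d + 1) := [set w | U (lsubmx w)].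
have lc (w : 'rV[R]_(d + 1)) : {for w, continuous (fun w : 'rV[R]_(d + 1) => lsubmx w)}.
  apply: continuous_coords => j.
  rewrite (_ : (fun u : 'rV[R]_(d + 1) => lsubmx u 0 j) = (fun u => u 0 (lshift 1 j))).
    exact: coord_continuous.
  by apply/funext => u; rewrite mxE.
have oA : open A.
  have := @open_preimage_in _ _ setT U (fun w : 'rV[R]_(d + 1) => lsubmx w) openT oU (fun w _ => lc w).
  by rewrite setTI.
have Ps j : smooth_on A (fun w => P w 0 j).
  rewrite (_ : (fun w => P w 0 j) =
     (fun w => ((fun u => p u 0 j) \o (fun w : 'rV[R]_(d + 1) => lsubmx w)) w +
               w 0 l * w 0 l * v 0 j)); last first.
    by apply/funext => w; rewrite /P !mxE expr2.
  apply: (smooth_on_add oA).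
    apply: (@smooth_on_comp _ _ _ A U) => // k.
    rewrite (_ : (fun u : 'rV[R]_(d + 1) => lsubmx u 0 k) = (fun u => u 0 (lshift 1 k))).
      exact: smooth_on_coord.
    by apply/funext => u; rewrite mxE.
  do 2![apply: (smooth_on_mul oA); last by [exact: smooth_on_coord|exact: smooth_on_cst]].
  exact: smooth_on_coord.
pose W := (A `&` [set w | `|w 0 l| < 1]) `&` P @^-1` O.
have oW : open W.
  apply: (open_preimage_in _ oO).
    apply: (openI oA).
    have -> : (fun w : 'rV[R]_(d + 1) => is_true (`|w 0 l| < 1)) = (fun w : 'rV[R]_(d + 1) => w 0 l) @^-1` (ball 0 1).
      by apply/seteqP; split=> w /=; rewrite -ball_normE /= sub0r normrN.
    by apply: open_comp => [w _|]; [exact: coord_continuous|exact: ball_open].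
  move=> w [Aw _]; apply: continuous_coords => j.
  by have [] := Ps j [::] w Aw.
have WS w : W w -> S (P w).
  move=> [[Aw w1] Ow]; apply: Sv => //; first exact: pU.
  rewrite sqr_ge0 /= -real_normK ?num_real// -[leRHS](expr1n _ 2).
  by rewrite lerXn2r ?nnegrE// ltW.
have Ks : smooth_on W (h \o P).
  by apply: hS => // j; apply: (smooth_on_sub _ (Ps j)) => w [[]].
have line (f : R -> 'rV[R]_d -> R) (w : 'rV[R]_(d + 1)) :
    'D_(e_ l) (fun w : 'rV[R]_(d + 1) => f (w 0 l) (lsubmx w)) w = 'D_1 (f ^~ (lsubmx w)) (w 0 l).
  rewrite /derive (_ : (fun t : R => _) =
    (fun t : R => t^-1 *: ((f ^~ (lsubmx w) \o shift (w 0 l)) (t *: 1) - f (w 0 l) (lsubmx w))))//.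
  apply/funext => t /=; congr (_ *: (f _ _ - _)).
    by rewrite !mxE !eqxx -[t *: 1]/(t * 1).
  by apply/rowP => j; rewrite !mxE eq_lrshift mulr0 add0r.
have [K KE] : exists K, K = iter_partial (h \o P) [:: l; l] by eexists.
have K2 w : K w = 'D_1 ('D_1 (fun t : R => h (p (lsubmx w) + t ^+ 2 *: v))) (w 0 l).
  rewrite KE /= (_ : 'D_(e_ l) (h \o P) = (fun w : 'rV[R]_(d + 1) => 'D_1 (fun t : R => h (p (lsubmx w) + t ^+ 2 *: v)) (w 0 l))).
    exact: (line (fun t u => 'D_1 (fun t : R => h (p u + t ^+ 2 *: v)) t)).
  by apply/funext => w'; exact: (line (fun t u => h (p u + t ^+ 2 *: v))).
have Ksm : smooth_on W K by rewrite KE; do 2 apply: smooth_on_partial.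
have E : {in U, (fun u => 2^-1 * (K \o (fun u => row_mx u (0 : 'rV[R]_1))) u) =1 square_derive v h \o p}.
  move=> u _; rewrite /comp; congr (_ * _).
  by rewrite K2 row_mxKl row_mxEr mxE.
apply: (smooth_on_ext oU E).
apply: (smooth_on_mul oU); first exact: smooth_on_cst.
apply: (smooth_on_comp oU oW Ksm).
- move=> j; have [k ->|k ->] := split_ordP j.
    rewrite (_ : (fun u : 'rV[R]_d => _) = (fun u => u 0 k)); first exact: smooth_on_coord.
    by apply/funext => u; rewrite row_mxEl.
  rewrite (_ : (fun u : 'rV[R]_d => _) = cst 0); first exact: smooth_on_cst.
  by apply/funext => u; rewrite row_mxEr mxE.
- move=> u Uu; split; first split.
  + by rewrite /A /= row_mxKl.
  + by rewrite /= row_mxEr mxE normr0.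
  + by rewrite /P /= row_mxKl row_mxEr mxE expr0n scale0r addr0; exact/SO/pU.
Qed.

(** By the chain rule the first derivative of t |-> h (x + t^2 v) is
    2 t (D_v h) (x + t^2 v); differentiate the product at 0. *)
Lemma square_derive_interior n (W : set 'rV[R]_n) (v : 'rV[R]_n) h x : open W ->
  smooth_on W h -> W x -> square_derive v h x = dir v h x.
Proof.
move=> oW hs Wx.
pose q (t : R) := x + t ^+ 2 *: v.
have q0 : q 0 = x by rewrite /q expr0n scale0r addr0.
have sq (t : R) : is_derive t (1 : R) (fun s : R => s ^+ 2) (2 * t).
  have := is_deriveM (is_derive_id t (1 : R)) (is_derive_id t (1 : R)).
  rewrite -[_ *: 1]/(t * 1) mulr1 -mulr2n mulr_natl => H.
  by rewrite (_ : (fun s : R => s ^+ 2) = (id : R -> R) * id)//.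
have Wq : \forall t \near (0 : R), W (q t).
  have qc : {for (0 : R), continuous q}.
    apply: continuous_coords => j; rewrite /q.
    rewrite (_ : (fun u : R => _) = (fun u : R => x 0 j + u * u * v 0 j)); last first.
      by apply/funext => u; rewrite !mxE expr2.
    apply: (@continuousD _ _ _ (cst (x 0 j)) (fun u : R => u * u * v 0 j)); first exact: cst_continuous.
    apply: (@continuousM _ _ (fun u : R => u * u) (cst (v 0 j))); last exact: cst_continuous.
    by apply: (@continuousM _ _ (id : R -> R) id) => ?; exact.
  apply: (qc W); rewrite q0; exact: (open_nbhs_nbhs (conj oW Wx)).
have dq f t : smooth_on W f -> W (q t) ->
    is_derive t (1 : R) (fun t => f (q t)) (dir v f (q t) * (2 * t)).
  move=> fs Wqt; have d1 := is_derive_dir oW fs Wqt.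
  exact: (is_derive_comp1 (sq t) d1).
have dirs : smooth_on W (dir v h).
  exact: smooth_on_dir.
have nE : \forall t \near (0 : R), 'D_1 (fun t => h (q t)) t = dir v h (q t) * (2 * t).
  by apply: filterS Wq => t Wqt; have [_ ->] := dq h t hs Wqt.
rewrite /square_derive (near_eq_derive _ nE).
have Wq0 : W (q 0) by rewrite q0.
have d2 : is_derive (0 : R) (1 : R) (fun t : R => 2 * t) 2.
  under eq_fun do rewrite mulrC; exact: is_derive_mulr.
have [_ ->] := is_deriveM (dq _ 0 dirs Wq0) d2.
by rewrite q0 mulr0 scale0r addr0 -[_ *: _]/(_ * _) mulrCA mulVf ?mulr1.
Qed.

End SquareDerivative.

(** * Extension from convex sets with interior points *)

Section BoundaryDerivatives.
Context {R : realType}.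
Local Notation e_ i := (delta_mx 0 i : 'rV[R]_ _).

Lemma plot_smooth_diff n (S : set 'rV[R]_n) c f g : plot_smooth S f -> plot_smooth S g ->
  plot_smooth S (fun x => c * (f x - g x)).
Proof.
move=> fS gS d U p oU ps pU.
rewrite (_ : _ \o p = (fun u => c * ((f \o p) u + -1 * (g \o p) u))); last first.
  by apply/funext => u /=; rewrite mulN1r.
apply: (smooth_on_mul oU); first exact: smooth_on_cst.
apply: (smooth_on_add oU); first exact: fS.
apply: (smooth_on_mul oU); [exact: smooth_on_cst|exact: gS].
Qed.

Lemma dir_shift n (v : 'rV[R]_n) (k : R) i h x :
  dir (v + k *: e_ i) h x = dir v h x + k * 'D_(e_ i) h x.
Proof.
rewrite /dir; under eq_bigr do rewrite !mxE mulrDl.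
rewrite big_split /= (bigD1 i (P := xpredT)) //=; congr (_ + _).
rewrite (bigD1 i (P := xpredT)) //= !eqxx mulr1 big1 ?addr0// => j ji.
by rewrite (negPf ji) mulr0 mul0r.
Qed.

(** The directions v and v + k e_i both point inwards, and the difference of the
    two one-sided derivatives is k times the partial derivative with respect to the
    i-th coordinate. *)
Theorem plot_smooth_iter_partial n (S O V : set 'rV[R]_n) (v : 'rV[R]_n) (k : R) h :
  open O -> S `<=` O -> open V -> V `<=` S -> k != 0 ->
  (forall w, w = v \/ (exists i, w = v + k *: e_ i) ->
     forall x t, S x -> 0 <= t <= 1 -> O (x + t *: w) -> S (x + t *: w)) ->
  plot_smooth S h ->
  forall s, exists2 hs, plot_smooth S hs & {in V, iter_partial h s =1 hs}.
Proof.
move=> oO SO oV VS k0 adm hS; elim=> [|i s [g gS gE]]; first by exists h.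
exists (fun x => k^-1 * (square_derive (v + k *: e_ i) g x - square_derive v g x)).
  apply: plot_smooth_diff; apply: (plot_smooth_square_derive oO) => //; apply: adm.
    by right; exists i.
  by left.
move=> x /set_mem Vx /=; rewrite (near_eq_derive _ (near_open_eq oV gE Vx)).
have gs := plot_smooth_on oV VS gS.
rewrite !(square_derive_interior _ oV gs Vx) dir_shift addrAC subrr add0r.
by rewrite mulrA mulVf// mul1r.
Qed.

Lemma plot_smooth_bounded n (S A : set 'rV[R]_n) (h : 'rV[R]_n -> R) :
  (forall x y t, S x -> S y -> 0 <= t <= 1 -> S (x + t *: (y - x))) ->
  A `<=` S -> compact A -> plot_smooth S h -> exists K, forall x, A x -> `|h x| <= K.
Proof.
move=> Sconv AS cA hS.
have [->|/set0P A0] := eqVneq A set0; first by exists 0.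
have hc : {within A, continuous (fun x => `|h x|)}.
  apply/subspace_continuousP => x Ax; apply: cvg_norm; apply/cvgrPdist_lt => eps eps0.
  have [d d0 dP] := @plot_smooth_continuous _ n S h x (fun y t => Sconv x y t (AS _ Ax)) hS eps eps0.
  rewrite near_withinE; apply: filterS (nbhsx_ballx x d d0) => y.
  rewrite -ball_normE /= => xy Ay.
  by rewrite distrC; apply: dP; [exact: AS|rewrite distrC].
have [c _ cM] := compact_EVT_max A0 cA hc.
by exists `|h c| => x Ax; apply: cM; rewrite inE.
Qed.

(** Every direction close to b - a points inwards at the points of C close to a,
    because it leads into the ball around b.  This provides the cones of
    [smooth_extension] and the inward directions of [plot_smooth_iter_partial]. *)
Theorem plot_smooth_extension_interior n (C K : set 'rV[R]_n) (a b : 'rV[R]_n) (r d : R) h :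
  (forall x y t, C x -> C y -> 0 <= t <= 1 -> C (x + t *: (y - x))) ->
  closed K -> K `<=` C -> 0 < r -> (forall x, C x -> `|x - a| < r -> K x) ->
  0 < d -> (forall x, `|x - b| < d -> C x) -> plot_smooth C h ->
  exists2 g, smooth_on setT g &
    exists2 r', 0 < r' & forall x, C x -> `|x - a| < r' -> g x = h x.
Proof.
move=> Cconv cK KC r0 CK d0 bC hC.
pose e := b - a.
(* the derivatives of h extend to C in the ball of radius r1 around a, are bounded
   in that of radius r2, and h is extended from that of radius r3 *)
pose r1 := Num.min r (Num.min 1 (d / 4)); pose r2 := r1 / 2; pose r3 := r2 / 4.
have r10 : 0 < r1 by rewrite !lt_min r0 ltr01 divr_gt0.
have r20 : 0 < r2 by rewrite divr_gt0.
have r1r : r1 <= r by rewrite ge_min lexx.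
have r1d : r1 <= d / 4 by rewrite !ge_min lexx !orbT.
have r11 : r1 <= 1 by rewrite !ge_min lexx /= orbT.
have r21 : r2 < r1 by rewrite /r2; lra.
pose O : set 'rV[R]_n := [set x | `|x - a| < r1].
have oball s : open [set x : 'rV[R]_n | `|x - a| < s].
  rewrite (_ : [set x | _] = ball a s); first exact: ball_open.
  by apply/seteqP; split=> x; rewrite -ball_normE /= distrC.
have oO : open O by exact: oball.
pose S := C `&` O.
have SO : S `<=` O by move=> x [].
have dirC x w t : C x -> `|x - a| <= d / 4 -> `|w - e| <= d / 2 -> 0 <= t <= 1 -> C (x + t *: w).
  move=> Cx xa we t01.
  rewrite (_ : x + t *: w = x + t *: ((x + w) - x)); last by congr (_ + _ *: _); rewrite addrC addKr.
  apply: Cconv => //; apply: bC.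
  rewrite (_ : x + w - b = (x - a) + (w - e)); last first.
    by apply/rowP => j; rewrite /e !mxE; ring.
  by apply: le_lt_trans (ler_normD _ _) _; lra.
have oI : open C° by exact: open_interior.
pose V := C° `&` O.
have oV : open V by exact: openI.
have VS : V `<=` S by move=> x [/interior_subset ? ?].
have hS : plot_smooth S h.
  by move=> m U p oU ps pU; apply: hC => // u /pU[].
have adm w : w = e \/ (exists i, w = e + (d / 2) *: e_ i) ->
     forall x t, S x -> 0 <= t <= 1 -> O (x + t *: w) -> S (x + t *: w).
  move=> we x t [Cx Ox] t01 Oxt; split=> //; apply: dirC => //.
    by apply: ltW; apply: lt_le_trans Ox _.
  case: we => [->|[i ->]]; first by rewrite subrr normr0; lra.
  rewrite addrC addKr; apply/rV_norm_le => [|j]; first by lra.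
  rewrite !mxE eqxx /= normrM ger0_norm; last by lra.
  by case: eqP => _; rewrite ?normr1 ?normr0; lra.
have d20 : d / 2 != 0 by rewrite gt_eqF// divr_gt0.
have ext := plot_smooth_iter_partial oO SO oV VS d20 adm hS.
have Sconv x y t : S x -> S y -> 0 <= t <= 1 -> S (x + t *: (y - x)).
  move=> [Cx Ox] [Cy Oy] t01; split; first exact: Cconv.
  rewrite /O /= (_ : _ - a = (1 - t) *: (x - a) + t *: (y - a)); last first.
    by apply/rowP => j; rewrite !mxE; ring.
  apply: le_lt_trans (ler_normD _ _) _; rewrite !normrZ.
  have /andP[t0 t1] := t01.
  rewrite (ger0_norm t0) ger0_norm ?subr_ge0//.
  rewrite /O /= in Ox Oy.
  have [->|tn0] := eqVneq t 0; first by rewrite mul0r addr0 subr0 mul1r.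
  have : t * `|y - a| < t * r1 by rewrite ltr_pM2l// lt_neqAle eq_sym tn0.
  have : (1 - t) * `|x - a| <= (1 - t) * r1 by rewrite ler_wpM2l ?subr_ge0// ltW.
  lra.
pose A := K `&` [set x | `|x - a| <= r2].
have AS : A `<=` S.
  by move=> x [/KC Cx xa]; split => //; exact: le_lt_trans r21.
have cA : compact A.
  apply: bounded_closed_compact.
    exists (`|a| + r2); split; first exact: num_real.
    move=> M MM x [_ xa]; apply: le_trans (ltW MM).
    rewrite -[x in `|x|](subrK a) addrC; apply: le_trans (ler_normD _ _) _.
    by rewrite lerD2l.
  apply: closedI => //.
  rewrite (_ : [set x | _] = closed_ball a r2); first exact: closed_ball_closed.
  rewrite closed_ballE//; apply/seteqP; split=> x /=; rewrite /closed_ball_ /= distrC//.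
pose W := C° `&` [set x | `|x - a| < r2].
have oW : open W by apply: openI => //; exact: oball.
have WV : W `<=` V by move=> x [Ix xa]; split => //; exact: lt_trans r21.
have WA : W `<=` A.
  move=> x [Ix xa]; split; last exact: ltW.
  apply: CK; first exact: interior_subset.
  by apply: lt_le_trans r1r; exact: lt_trans r21.
have hW : smooth_on W h by apply: (smooth_on_sub WV); exact: (plot_smooth_on oV VS).
have hb s : exists M, forall x, W x -> `|iter_partial h s x| <= M.
  have [g gS gE] := ext s; have [M gM] := plot_smooth_bounded Sconv AS cA gS.
  by exists M => x Wx; rewrite gE ?inE; [exact/gM/WA|exact: WV].
pose Q := C `&` [set x | `|x - a| < r3].
pose rr := Num.min 1 (d / 4).
have rr0 : 0 < rr by rewrite lt_min ltr01 divr_gt0.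
have rr1 : rr <= 1 by rewrite ge_min lexx.
have rrd : rr <= d / 4 by rewrite ge_min lexx orbT.
pose s0 := Num.min 1 (r2 / 2 / (1 + `|e|)).
have e10 : 0 < 1 + `|e| by rewrite ltr_pwDl.
have s00 : 0 < s0 by rewrite lt_min ltr01 !divr_gt0.
have s01 : s0 <= 1 by rewrite ge_min lexx.
have s0e : s0 * (1 + `|e|) <= r2 / 2 by rewrite -ler_pdivlMr// ge_min lexx orbT.
have rr01 : 0 < rr <= 1 by rewrite rr0.
have QM q : Q q -> `|q| <= `|a| + r3.
  move=> [_ qa]; rewrite -[q in `|q|](subrK a) addrC; apply: le_trans (ler_normD _ _) _.
  by rewrite lerD2l ltW.
have cone q y s : Q q -> 0 < s <= s0 -> `|y - q| <= rr * s -> W (y + s *: e).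
  move=> [Cq qa] /andP[sp ss] yq.
  have qa' : `|q - a| < r3 by [].
  split; last first.
    rewrite /= (_ : y + s *: e - a = (y - q) + (q - a) + s *: e); last first.
      by apply/rowP => j; rewrite !mxE; ring.
    apply: le_lt_trans (ler_normD _ _) _; rewrite normrZ (gtr0_norm sp).
    have := ler_normD (y - q) (q - a).
    have : s * (1 + `|e|) <= s0 * (1 + `|e|) by rewrite ler_pM2r.
    have : rr * s <= 1 * s by rewrite ler_pM2r.
    rewrite /r3 in qa'; lra.
  have sd0 : 0 < s * (d / 4) by rewrite mulr_gt0 ?divr_gt0.
  apply: filterS (nbhsx_ballx (y + s *: e) _ sd0) => z.
  rewrite -ball_normE /= distrC => zy.
  rewrite (_ : z = q + s *: (s^-1 *: (z - q))); last first.
    by rewrite scalerA mulfV ?scale1r ?[q + _]addrC ?subrK// gt_eqF.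
  apply: dirC => //.
  - by apply: ltW; apply: lt_le_trans qa' _; rewrite /r3 /r2; lra.
  - rewrite (_ : _ - e = s^-1 *: ((z - (y + s *: e)) + (y - q))); last first.
      have sn : s != 0 by rewrite gt_eqF.
      by apply/rowP => j; rewrite !mxE; field.
    rewrite normrZ normfV (gtr0_norm sp) mulrC ler_pdivrMr//.
    apply: le_trans (ler_normD _ _) _.
    have : rr * s <= d / 4 * s by rewrite ler_pM2r.
    lra.
  - by rewrite ltW//=; exact: le_trans s01.
have hlim q : Q q -> h (q + t *: e) @[t --> 0^'+] --> h q.
  move=> [Cq qa].
  have qa' : `|q - a| < r3 by [].
  have Sq : S q by split => //; apply: lt_trans qa' _; rewrite /r3; lra.
  apply/cvgrPdist_lt => eps eps0.
  have [dl dl0 dlP] := plot_smooth_continuous (fun y t => Sconv q y t Sq) hS eps0.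
  near=> t.
  have t0 : 0 < t by [].
  have t1 : t <= 1 by near: t; exact: nbhs_right_le.
  have te (rho : R) : 0 < rho -> t <= rho / (1 + `|e|) -> `|t *: e| < rho.
    move=> rho0; rewrite ler_pdivlMr// normrZ (gtr0_norm t0) => tr.
    by apply: lt_le_trans tr; rewrite ltr_pM2l// ltrDr.
  rewrite distrC; apply: dlP.
    split.
      apply: dirC => //; first by apply: ltW; apply: lt_le_trans qa' _; rewrite /r3 /r2; lra.
        by rewrite subrr normr0; lra.
      by rewrite ltW.
    rewrite /O /= addrAC; apply: le_lt_trans (ler_normD _ _) _.
    have : `|t *: e| < r2.
      by apply: te => //; near: t; apply: nbhs_right_le; rewrite divr_gt0.
    rewrite /r3 in qa'; rewrite /r2 in qa' *; lra.
  rewrite addrAC subrr add0r; apply: te => //.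
  by near: t; apply: nbhs_right_le; rewrite divr_gt0.
have [g gs gQ] := smooth_extension oW rr01 s00 QM cone hW hb hlim.
exists g => //; exists r3; first by rewrite divr_gt0.
by move=> x Cx xa; apply: gQ.
Unshelve. all: by end_near. Qed.

End BoundaryDerivatives.

(** * Extension from arbitrary convex sets *)

Section Thicken.
Context {R : realType}.

(** The point a takes the remaining weight 1 - sum l. *)
Lemma convex_comb n (C : set 'rV[R]_n) (a : 'rV[R]_n) k (B : 'I_k -> 'rV[R]_n) (l : 'I_k -> R) :
  (forall x y t, C x -> C y -> 0 <= t <= 1 -> C (x + t *: (y - x))) ->
  C a -> (forall j, C (a + B j)) -> (forall j, 0 <= l j) -> \sum_j l j <= 1 ->
  C (a + \sum_j l j *: B j).
Proof.
move=> Cconv Ca; elim: k B l => [|k IH] B l CB l0 l1.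
  by rewrite big_ord0 addr0.
rewrite big_ord_recr /= in l1; rewrite big_ord_recr /=.
set m := l ord_max; set s := \sum_(i < k) _ in l1.
have s0 : 0 <= s by apply: sumr_ge0.
have m0 : 0 <= m by apply: l0.
have [m1|m1] := eqVneq m 1.
  have lz j : l (widen_ord (leqnSn k) j) = 0.
    have sz : s = 0 by move: l1; rewrite -/m m1; lra.
    by move/eqP: sz; rewrite psumr_eq0// => /allP/(_ j); rewrite mem_index_enum => /(_ isT)/eqP.
  by rewrite big1 ?add0r ?m1 ?scale1r// => j _; rewrite lz scale0r.
have m2 : m < 1 by move: l1; rewrite -/m lt_neqAle m1 /=; lra.
have n0 : 1 - m != 0 by rewrite gt_eqF// subr_gt0.
pose y := a + \sum_(j < k) (l (widen_ord (leqnSn k) j) / (1 - m)) *: B (widen_ord (leqnSn k) j).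
have Cy : C y.
  apply: IH => [j|j|]; first exact: CB.
    by rewrite divr_ge0 ?l0// subr_ge0 ltW.
  by rewrite -mulr_suml ler_pdivrMr ?subr_gt0// -/s mul1r; move: l1; rewrite -/m; lra.
have -> : a + (\sum_(i < k) l (widen_ord (leqnSn k) i) *: B (widen_ord (leqnSn k) i) + m *: B ord_max) =
    y + m *: ((a + B ord_max) - y).
  have -> : \sum_(i < k) l (widen_ord (leqnSn k) i) *: B (widen_ord (leqnSn k) i) = (1 - m) *: (y - a).
    rewrite /y addrAC subrr add0r scaler_sumr; apply: eq_bigr => j _.
    by rewrite scalerA mulrC mulfVK.
  by apply/rowP => j; rewrite !mxE; ring.
by apply: Cconv => //; rewrite m0 ltW.
Qed.

(** A maximal free family of vectors joining a to points of C. *)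
Lemma affine_basis n (C : set 'rV[R]_n) (a : 'rV[R]_n) :
  exists k (B : 'M[R]_(k, n)), [/\ row_free B, forall j, C (a + row j B) &
    forall c, C c -> (c - a <= B)%MS].
Proof.
pose P k := `[< exists B : 'M[R]_(k, n), row_free B /\ forall j, C (a + row j B) >].
have P0 : exists k, P k.
  by exists 0%N; apply/asboolP; exists 0; split=> [|[]//]; rewrite /row_free mxrank0.
have Pn k : P k -> (k <= n)%N.
  by move=> /asboolP[B [/eqP Bf _]]; have := rank_leq_col B; rewrite Bf.
case: (ex_maxnP P0 Pn) => k /asboolP[B [Bf CB]] kmax.
exists k, B; split => // c Cc; apply: contraT => cB.
have : P (k + 1)%N.
  apply/asboolP; exists (col_mx B (c - a)); split.
    rewrite /row_free eqn_leq rank_leq_row -addsmxE.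
    have : (B < B + (c - a))%MS.
      rewrite /ltmx addsmxSl /=; apply: contra cB; apply: submx_trans.
      exact: addsmxSr.
    by rewrite ltmxErank (eqP Bf) addn1 => /andP[].
  move=> j; have [i ->|i ->] := split_ordP j.
    by rewrite rowKu; exact: CB.
  have -> : row (rshift k i) (col_mx B (c - a)) = c - a.
    by rewrite rowKd; apply/rowP => l; rewrite [LHS]mxE ord1.
  by rewrite addrC subrK.
by move=> /kmax; rewrite addn1 ltnn.
Qed.

Lemma smooth_on_affine_map n m (U : set 'rV[R]_n) d (p : 'rV[R]_n -> 'rV[R]_d)
    (a : 'rV[R]_d) (M : 'M[R]_(d, m)) (c : 'rV[R]_m) j : open U ->
  (forall i, smooth_on U (fun u => p u 0 i)) ->
  smooth_on U (fun u => (c + (p u - a) *m M) 0 j).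
Proof.
move=> oU ps.
rewrite (_ : (fun u => _) = (fun u => c 0 j + \sum_i (p u 0 i + - a 0 i) * M i j)); last first.
  apply/funext => u; rewrite !mxE; congr (_ + _); apply: eq_bigr => i _; by rewrite !mxE.
apply: (smooth_on_add oU); first exact: smooth_on_cst.
apply: (@smooth_on_sum _ _ U oU _ _ (fun i u => (p u 0 i + - a 0 i) * M i j)) => i.
apply: (smooth_on_mul oU); last exact: smooth_on_cst.
by apply: (smooth_on_add oU); [exact: ps|exact: smooth_on_cst].
Qed.

(** Replace C by its preimage under the affine projection onto its affine hull.
    A barycentre of a with the points of [affine_basis] is interior to it, since
    nearby points have projections with nonnegative barycentric coordinates. *)
Theorem plot_smooth_extension n (C K : set 'rV[R]_n) (a : 'rV[R]_n) (r : R) h :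
  (forall x y t, C x -> C y -> 0 <= t <= 1 -> C (x + t *: (y - x))) -> C a ->
  closed K -> K `<=` C -> 0 < r -> (forall x, C x -> `|x - a| < r -> K x) ->
  plot_smooth C h ->
  exists2 g, smooth_on setT g &
    exists2 r', 0 < r' & forall x, C x -> `|x - a| < r' -> g x = h x.
Proof.
move=> Cconv Ca cK KC r0 CK hC.
have [k [B [Bf CB spanB]]] := affine_basis C a.
pose pr (x : 'rV[R]_n) := a + (x - a) *m (pinvmx B *m B).
pose la (x : 'rV[R]_n) := 0 + (x - a) *m pinvmx B.
have prC c : C c -> pr c = c.
  by move=> /spanB cB; rewrite /pr mulmxA mulmxKpV// addrC subrK.
have idsm m (j : 'I_m) : smooth_on setT (fun u : 'rV[R]_m => u 0 j).
  by apply: smooth_on_coord; exact: openT.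
have cont m (f : 'rV[R]_n -> 'rV[R]_m) : (forall j, smooth_on setT (fun u => f u 0 j)) -> continuous f.
  move=> fs x; apply: continuous_coords => j.
  by have [] := fs j [::] x Logic.I.
have prcont : continuous pr.
  by apply: cont => j; apply: smooth_on_affine_map; [exact: openT|move=> i; exact: idsm].
have lacont : continuous la.
  by apply: cont => j; apply: smooth_on_affine_map; [exact: openT|move=> i; exact: idsm].
pose C' := pr @^-1` C.
have prE x : pr x = a + \sum_j la x 0 j *: row j B.
  by rewrite /pr /la add0r mulmxA mulmx_sum_row.
have [iv [iv0 iv1 ivk]] : exists iv : R, [/\ 0 < iv, iv <= 1 & iv * k%:R = 1 - iv].
  exists k.+1%:R^-1; split; first by rewrite invr_gt0 ltr0n.
    by rewrite invf_le1 ?ltr0n// ler1n.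
  by rewrite -natr1; field; rewrite natr1 pnatr_eq0.
pose b := a + (const_mx iv : 'rV[R]_k) *m B.
have lab : la b = const_mx iv.
  by rewrite /la /b add0r addrC addKr -mulmxA mulmxVp// mulmx1.
have [d d0 bC'] : exists2 d, 0 < d & forall x, `|x - b| < d -> C' x.
  have eps0 : 0 < iv * iv by rewrite mulr_gt0.
  have /cvgrPdist_lt/(_ _ eps0)/nbhs_normP[d /= d0 dP] := lacont b.
  exists d => // x; rewrite distrC => /dP; rewrite lab => lax.
  have lx j : `|iv - la x 0 j| < iv * iv.
    by have := (rV_norm_lt _ eps0).1 lax j; rewrite !mxE.
  have kk : iv * iv <= iv by rewrite ler_piMl// ltW.
  rewrite /C' /= prE; apply: convex_comb => // [j|].
    by have := lx j; rewrite ltr_norml => /andP[? ?]; lra.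
  apply: (@le_trans _ _ (\sum_(j < k) (iv + iv * iv))).
    by apply: ler_sum => j _; have := lx j; rewrite ltr_norml => /andP[? ?]; lra.
  rewrite sumr_const card_ord -[leLHS]mulr_natr mulrDl -mulrA ivk mulrBr; lra.
have C'conv x y t : C' x -> C' y -> 0 <= t <= 1 -> C' (x + t *: (y - x)).
  move=> Cx Cy t01; rewrite /C' /=.
  have -> : pr (x + t *: (y - x)) = pr x + t *: (pr y - pr x).
    rewrite /pr -[RHS]addrA; congr (_ + _).
    have -> : x + t *: (y - x) - a = (x - a) + t *: ((y - a) - (x - a)).
      by apply/rowP => j; rewrite !mxE; ring.
    rewrite mulmxDl -scalemxAl (mulmxBl (y - a) (x - a)); congr (_ + _ *: _).
    by rewrite [in RHS]opprD addrACA subrr add0r.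
  exact: Cconv.
have cK' : closed (pr @^-1` K) by apply: closed_comp => // x _; exact: prcont.
have pra : pr a = a by exact: prC.
have [r' r'0 r'P] : exists2 r', 0 < r' & forall x, `|x - a| < r' -> `|pr x - a| < r.
  have /cvgrPdist_lt/(_ _ r0)/nbhs_normP[r' /= r'0 r'P] := prcont a.
  by exists r' => // x; rewrite distrC => /r'P; rewrite pra distrC.
have K'C' : pr @^-1` K `<=` C' by move=> x; exact: KC.
have CK' x : C' x -> `|x - a| < r' -> (pr @^-1` K) x.
  by move=> Cx xa; apply: CK => //; exact: r'P.
have hC' : plot_smooth C' (h \o pr).
  move=> m U p oU ps pU; apply: (hC m U (pr \o p)) => // j.
  exact: smooth_on_affine_map.
have [g gs [s s0 gE]] := plot_smooth_extension_interior C'conv cK' K'C' r'0 CK' d0 bC' hC'.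
exists g => //; exists s => // x Cx xa.
by rewrite gE//= ?prC// /C' /= prC.
Qed.

End Thicken.

(** * Convex charts of a Sikorski space *)

Section Charts.
Context {R : realType}.

(** Smooth functions are continuous, so the initial topology is not finer than
    the usual one. *)
Lemma nbhs_cartesian n (x : 'rV[R]_n) (W : set 'rV[R]_n) :
  nbhs (x : sikorski_space (cartesian_smooth R n)) W -> nbhs x W.
Proof.
move: W; apply/(@sikorski_cvgP R _ (cartesian_smooth R n) (nbhs (x : 'rV[R]_n)) x) => f fs.
by have [] := fs [::] x I.
Qed.

Lemma subspace_sikorski_restr (X : Type) (F : set (X -> R)) (V : set X) (g : X -> R) :
  F g -> subspace_sikorski F V (fun v : V => g (\val v)).
Proof. by move=> Fg v; exists setT, g; split => //; exact: filterT. Qed.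

(** Derivatives and limits are stated for total functions, whence the default value
    y0. *)
Definition extend (X Y : Type) (A : set X) (y0 : Y) (f : A -> Y) (x : X) : Y :=
  if pselect (A x) is left Ax then f (SigSub (mem_set Ax)) else y0.

Lemma extend_val (X Y : Type) (A : set X) (y0 : Y) (f : A -> Y) (a : A) :
  extend y0 f (\val a) = f a.
Proof.
rewrite /extend; case: pselect => [Ax|nA]; last by case: nA; exact: set_valP.
by congr f; apply: val_inj.
Qed.

Lemma sub_of (X : Type) (A : set X) x : A x -> exists a : A, \val a = x.
Proof. by move=> Ax; exists (SigSub (mem_set Ax)). Qed.

Section LocalChart.
Variables (X : Type) (F : set (X -> R)) (V : set X) (n : nat) (C : set 'rV[R]_n).
Variables (phi : V -> C) (psi : C -> V).
Hypotheses (phiK : cancel phi psi) (psiK : cancel psi phi).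
Hypothesis phis : sikorski_smooth (subspace_sikorski F V)
  (subspace_sikorski (cartesian_smooth R n) C) phi.
Hypothesis psis : sikorski_smooth (subspace_sikorski (cartesian_smooth R n) C)
  (subspace_sikorski F V) psi.

Let Phi : sikorski_space F -> 'rV[R]_n := extend 0 (fun v : V => \val (phi v)).

Let PhiE (v : V) : Phi (\val v) = \val (phi v).
Proof. exact: extend_val. Qed.

Let Phi_continuous (v : V) :
  Phi @ within V (nbhs (\val v : sikorski_space F)) --> \val (phi v).
Proof.
rewrite -PhiE.
apply/cvgrPdist_lt => eps eps0.
suff : \forall z \near within V (nbhs (\val v : sikorski_space F)),
    forall j, `|Phi (\val v) 0 j - Phi z 0 j| < eps.
  by apply: filterS => z zP; apply/rV_norm_lt => // j; rewrite !mxE.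
apply: (@filter_forall _ _ _ (within V (nbhs (\val v : sikorski_space F))) _) => j.
have cj : cartesian_smooth R n (fun u : 'rV[R]_n => u 0 j).
  by apply: smooth_on_coord; exact: openT.
have [W [g [vW Fg gE]]] := phis (@subspace_sikorski_restr _ _ C _ cj) v.
have /cvgrPdist_lt/(_ _ eps0) gc := @sikorski_continuous R X F g Fg (\val v).
rewrite near_withinE; apply: filterS (filterI vW gc) => z [Wz gz] Vz.
have [w wz] := @sub_of X V z Vz; rewrite -wz in Wz gz *.
rewrite /= !PhiE.
have Wv := nbhs_singleton vW.
by rewrite (gE v Wv) (gE w Wz) /= in gz.
Qed.

(** A compact subset of a chart domain has compact, hence closed, image in R^n. *)
Lemma chart_compact (K : set (sikorski_space F)) : K `<=` V -> compact K ->
  closed (Phi @` K).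
Proof.
move=> KV cK; apply: compact_closed; first exact: norm_hausdorff.
apply: continuous_compact => //.
apply/subspace_continuousP => x Kx; have [v vx] := @sub_of X V x (KV x Kx).
suff : Phi @ within K (nbhs (\val v : sikorski_space F)) --> \val (phi v).
  by rewrite -PhiE vx.
apply: cvg_trans (@Phi_continuous v).
by apply: cvg_app; exact: within_subset.
Qed.

(** The inverse chart is continuous for the usual topology of C: composed with it, a
    function of F is locally the restriction of a smooth function on R^n. *)
Lemma chart_inverse_continuous (K : set (sikorski_space F)) (c : C) :
  nbhs (\val (psi c) : sikorski_space F) K ->
  exists2 r, 0 < r & forall y, C y -> `|y - \val c| < r -> exists2 z, K z /\ V z & Phi z = y.
Proof.
move=> cK.
pose Psi : 'rV[R]_n -> sikorski_space F := extend (\val (psi c)) (fun c : C => \val (psi c)).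
have : Psi @ within C (nbhs (\val c)) --> (\val (psi c) : sikorski_space F).
  apply/sikorski_cvgP => g Fg.
  have [W [g' [cW gs gE]]] := psis (@subspace_sikorski_restr _ _ V _ Fg) c.
  have gc : g' @ nbhs (\val c) --> g' (\val c) by have [] := gs [::] (\val c) I.
  have <- : g' (\val c) = g (\val (psi c)) by rewrite (gE c)//; exact: nbhs_singleton cW.
  have gw : g' @ within C (nbhs (\val c)) --> g' (\val c) by exact: cvg_within_filter gc.
  suff : (g \o Psi) @ within C (nbhs (\val c)) --> g' (\val c) by [].
  apply: cvg_trans gw; apply: near_eq_cvg.
  rewrite near_withinE; apply: filterS (nbhs_cartesian cW) => y Wy Cy.
  by have [w wy] := sub_of Cy; rewrite -wy in Wy *; rewrite /Psi /= extend_val gE.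
move=> /(_ K cK) cKP; have {}cKP : \forall y \near \val c, C y -> K (Psi y) by exact: cKP.
have [r /= r0 rP] := (nbhs_normP _ _).1 cKP.
exists r => // y Cy; rewrite distrC => yr; have := rP y yr Cy.
have [w <-] := sub_of Cy; rewrite /Psi extend_val => Kw.
exists (\val (psi w)); last by rewrite PhiE psiK.
by split => //; exact: set_valP.
Qed.

(** Composing a smooth map into C with the inverse chart yields a plot of X. *)
Lemma chart_plot_smooth f : Phi_sikorski (Pi_diffeology F) f ->
  plot_smooth C (extend 0 (fun c : C => f (\val (psi c)))).
Proof.
move=> fPhi d U p oU ps pU.
have pc x : U x -> {for x, continuous p}.
  by move=> Ux; apply: continuous_coords => j; have [] := ps j [::] x Ux.
pose pC (u : U) : C := SigSub (mem_set (pU _ (set_valP u))).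
pose ph (u : U) : X := \val (psi (pC u)).
have phP : @Pi_diffeology R X F d U ph.
  split => // g Fg.
  pose G : 'rV[R]_n -> R := extend 0 (fun c : C => g (\val (psi c))).
  exists (G \o p) => [|u]; last first.
    by rewrite /ph /= /G -[p _]/(\val (pC u)) extend_val.
  apply: smooth_on_local => x Ux.
  have [c cx] := sub_of (pU x Ux).
  have [W [g' [cW gs gE]]] := psis (@subspace_sikorski_restr _ _ V _ Fg) c.
  have oW : open W° by exact: open_interior.
  exists (U `&` p @^-1` W°), (g' \o p); split.
  - exact: open_preimage_in.
  - by split=> //; rewrite /= -cx; exact: (nbhs_cartesian cW).
  - apply: (@smooth_on_comp _ _ _ _ setT) => //.
    + exact: open_preimage_in.
    + exact: openT.
    + by move=> j; apply: (smooth_on_sub _ (ps j)) => y [].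
  - move=> y /set_mem[Uy Wy]; have [w wy] := sub_of (pU y Uy).
    rewrite /= -wy /G extend_val; apply/esym/(gE w).
    by rewrite wy; exact: interior_subset Wy.
have [_ [G Gs GE]] := fPhi d U ph phP.
apply: (smooth_on_ext oU _ Gs) => u /set_mem Uu.
have [w wu] := sub_of Uu.
rewrite -wu GE /ph /= -[p _]/(\val (pC w)) extend_val//.
Qed.

(** A compact neighbourhood contained in the chart domain, closed by regularity,
    makes C locally closed at the point; the smooth extension of f in the chart is
    then pulled back by the chart. *)
Lemma chart_reflexive f (x : sikorski_space F) : convex_set C ->
  locally_compact [set: sikorski_space F] -> nbhs x V ->
  Phi_sikorski (Pi_diffeology F) f ->
  exists (W : set X) (g : X -> R), [/\ nbhs x W, F g & forall y, W y -> g y = f y].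
Proof.
move=> Cconv Xlc xV fPhi.
have [v vx] := @sub_of X V x (nbhs_singleton xV).
pose c := phi v.
have [K xK cK] := (@sikorski_locally_compactP R X F).1 Xlc x.
have [B xB BK] := @sikorski_regular R X F x _ (filterI xK xV).
pose K1 := closure B.
have xK1 : nbhs x K1 by apply: filterS xB; exact: subset_closure.
have cK1 : compact K1.
  by apply: (subclosed_compact (@closed_closure _ B) cK) => z /BK[].
have K1V : K1 `<=` V by move=> z /BK[].
have psic : nbhs (\val (psi c) : sikorski_space F) K1 by rewrite /c phiK vx.
have [r r0 rP] := chart_inverse_continuous psic.
have Cc : forall y z t, C y -> C z -> 0 <= t <= 1 -> C (y + t *: (z - y)).
  move=> y z t Cy Cz /andP[t0 t1].
  have := Cconv z y (Itv01 t0 t1) (mem_set Cz) (mem_set Cy).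
  have -> : y + t *: (z - y) = t *: z + (1 - t) *: y.
    by apply/rowP => j; rewrite !mxE; ring.
  by move=> /set_mem.
have KC : Phi @` K1 `<=` C.
  move=> _ [z K1z <-]; have [w <-] := @sub_of X V z (K1V _ K1z).
  by rewrite PhiE; exact: set_valP.
have CK y : C y -> `|y - \val c| < r -> (Phi @` K1) y.
  by move=> Cy /(rP y Cy)[z [K1z _] <-]; exists z.
have Cvc : C (\val c) by exact: set_valP.
have [g gs [s s0 gE]] := plot_smooth_extension Cc Cvc (chart_compact K1V cK1) KC r0 CK
  (chart_plot_smooth fPhi).
have [W [g1 [xW Fg1 g1E]]] := phis (@subspace_sikorski_restr _ _ C _ gs) v.
rewrite vx in xW.
have /cvgrPdist_lt/(_ _ s0) := @Phi_continuous v.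
rewrite near_withinE vx => xs.
exists (V `&` W `&` [set z | V z -> `|\val (phi v) - Phi z| < s]), g1; split => //.
  exact: filterI (filterI xV xW) xs.
move=> y [[Vy Wy] ys]; have {ys} := ys Vy; have [w wy] := @sub_of X V y Vy.
rewrite -wy in Wy *; rewrite PhiE distrC => ws.
rewrite g1E//= gE//; last exact: set_valP.
by rewrite extend_val phiK.
Qed.

End LocalChart.
End Charts.

Theorem theorem5p6 (R : realType) (X : Type) (F : set (X -> R))
  (F_sikorski : is_sikorski F)
  (X_locally_compact : locally_compact [set: sikorski_space F])
  (X_locally_convex : forall x : sikorski_space F,
    exists2 V : set X, nbhs x V &
    exists (n : nat) (C : set 'rV[R]_n),
      convex_set C /\
      sikorski_diffeomorphic
        (subspace_sikorski F V)
        (subspace_sikorski (cartesian_smooth R n) C)) :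
  reflexive_sikorski F.
Proof.
apply/seteqP; split=> f; last first.
  by move=> Ff d U p [oU ps]; split => //; exact: ps.
move=> fPhi; apply: (sikorski_local F_sikorski) => x.
have [V xV [n [C [Cconv [phi [psi [phiK psiK phis psis]]]]]]] := X_locally_convex x.
exact: (chart_reflexive phiK psiK phis psis Cconv X_locally_compact xV fPhi).
Qed.
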